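(* Let $\Gamma=(G,\{\rho_0,\ldots,\rho_{r-1}\})$ be a string C-group of rank $r$, where $G$ is a transitive group of even permutations of degree $11$. If $r\in\{4,5\}$ and $G\cong\mathrm{PSL}_2(11)$, then $\Gamma$ is (the string C-group of) the abstract regular $4$-polytope known as the $11$-cell, and $\Gamma$ has the following permutation representation graph: with the $11$ vertices suitably named $1,\ldots,11$, - the $0$-edges are $\{1,2\},\{5,6\},\{8,9\},\{10,11\}$; - the $1$-edges are $\{2,3\},\{4,5\},\{7,8\},\{10,11\}$; - the $2$-edges are $\{3,4\},\{5,6\},\{8,10\},\{9,11\}$; - the $3$-edges are $\{4,7\},\{5,8\},\{6,9\},\{10,11\}$.
   Context: A string group generated by involutions (sggi) of rank $r$ is a pair $\Gamma=(G,\{\rho_0,\ldots,\rho_{r-1}\})$ where $G$ is generated by the ordered set of involutions $\{\rho_0,\ldots,\rho_{r-1}\}$ and $(\rho_i\rho_j)^2=1$ whenever $|i-j|>1$. It is a string C-group if moreover $\langle \rho_j\mid j\in J\rangle\cap\langle\rho_k\mid k\in K\rangle=\langle\rho_j\mid j\in J\cap K\rangle$ for all $J,K\subseteq\{0,\ldots,r-1\}$. String C-groups of rank $r$ correspond one-to-one to abstract regular polytopes of rank $r$ (also called $r$-polytopes), $G$ being the automorphism group of the polytope. If $G$ is a permutation group of degree $n$, the permutation representation graph of $\Gamma$ is the edge-labelled multigraph whose vertices are the $n$ points, with an edge $\{a,b\}$ labelled $i$ (an $i$-edge) whenever $a\rho_i=b$ and $a\neq b$. The $11$-cell is the self-dual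 abstract regular polytope of rank $4$ and type $\{3,5,3\}$ (the orders of $\rho_0\rho_1,\rho_1\rho_2,\rho_2\rho_3$) discovered by Coxeter and Grünbaum, with hemi-icosahedral facets, hemi-dodecahedral vertex-figures and automorphism group $\mathrm{PSL}_2(11)$.
   Formalization: The permutation representation graph is asserted only up to duality: either Γ or its dual (generators in reversed order) has the printed graph, since the dual of a Γ with the printed graph satisfies all hypotheses but has a different graph. *)

(* Defs.v *)
From HB Require Import structures.
From mathcomp Require Import all_boot all_order all_algebra.
From mathcomp Require Import all_fingroup all_solvable.

Set Implicit Arguments.
Unset Strict Implicit.
Unset Printing Implicit Defensive.

Import GroupScope.

Section SpecialLinear.
Variables (n : nat) (R : finComUnitRingType).

Definition SL : {set {'GL_n[R]}} := [set A | (\det (GLval A) == 1)%R].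

Lemma SL_group_set : group_set SL.
Proof.
apply/group_setP; split=> [|A B]; first by rewrite inE GL_1E det1.
by rewrite !inE GL_ME det_mulmx => /eqP -> /eqP ->; rewrite GRing.mulr1.
Qed.

Canonical SL_group := group SL_group_set.

Definition PSL := SL / 'Z(SL).

End SpecialLinear.

Arguments SL n%_N R%_type.
Arguments PSL n%_N R%_type.

(* The ordered generators rho_0, ..., rho_{r-1} form a sequence rho of size r;
   the default value 1 of nth is only met at indices outside 0..r-1. *)

Definition sggi (gT : finGroupType) (G : {group gT}) (rho : seq gT) : Prop :=
  [/\ G :=: <<[set x in rho]>>,
      {in rho, forall x, #[x] = 2}
    & forall i j : 'I_(size rho), (i.+1 < j) || (j.+1 < i) ->
        (nth 1 rho i * nth 1 rho j) ^+ 2 = 1].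

Definition parabolic (gT : finGroupType) (rho : seq gT)
    (J : {set 'I_(size rho)}) : {set gT} :=
  <<[set nth 1 rho j | j : 'I_(size rho) in J]>>.

Definition string_C_group (gT : finGroupType) (G : {group gT})
    (rho : seq gT) : Prop :=
  sggi G rho /\
  forall J K : {set 'I_(size rho)},
    parabolic J :&: parabolic K = parabolic (J :&: K).

Definition schlafli_type (gT : finGroupType) (rho : seq gT) : seq nat :=
  [seq #[nth 1 rho i * nth 1 rho i.+1] | i <- iota 0 (size rho).-1].

Definition self_dual (gT : finGroupType) (G : {group gT}) (rho : seq gT) :
    Prop :=
  exists2 a : {perm gT}, a \in Aut G & [seq a x | x <- rho] = rev rho.

(* A finite abstract polytope is given by the poset of its proper faces. *)

Definition poset_aut (F : finType) (le : rel F) : {set {perm F}} :=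
  [set s : {perm F} | [forall x, forall y, le (s x) (s y) == le x y]].

Definition is_flag (F : finType) (le : rel F) (phi : seq F) : Prop :=
  sorted [rel x y | (x != y) && le x y] phi /\
  forall x, (forall y, y \in phi -> le x y || le y x) -> x \in phi.

(* (G, rho) is the string C-group of a regular polytope: G is its automorphism
   group, and rho_i sends a base flag phi to the flag that differs from phi
   exactly in its face of rank i. *)
Definition is_string_group_of (F : finType) (le : rel F)
    (gT : finGroupType) (G : {group gT}) (rho : seq gT) : Prop :=
  exists (f : {morphism G >-> {perm F}}) (phi : (size rho).-tuple F),
    [/\ isom G (poset_aut le) f,
        is_flag le phi
      & forall i j : 'I_(size rho),
          (f (nth 1 rho i) (tnth phi j) == tnth phi j) = (i != j)].

(* The hemi-icosahedron is the icosahedron modulo its antipodal map. Its six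
   vertices are the axes of the icosahedron: 5 is the axis through the poles,
   and 0, ..., 4 are the axes through the upper ring of five vertices, in cyclic
   order. Above the equator the icosahedron has the triangles {5, i, i+1}, and
   the triangles with an edge {i, i+1} of the upper ring and a vertex of the
   lower ring, which is the antipode of the ring vertex i+3 (indices mod 5);
   the other ten triangles are antipodal to these. Any two axes span one edge. *)
Definition axis (k : nat) : 'I_6 := inord (k %% 5).

Definition hemi_icosahedron_triangle (S : {set 'I_6}) : bool :=
  [exists i : 'I_5,
     (S == [set ord_max; axis i; axis i.+1]) ||
     (S == [set axis i; axis i.+1; axis (i + 3)])].

Definition hemi_icosahedron_face (S : {set 'I_6}) : bool :=
  [|| #|S| == 1%N, #|S| == 2 | hemi_icosahedron_triangle S].

Definition hemi_face := {S : {set 'I_6} | hemi_icosahedron_face S}.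

Definition hemi_icosahedron : rel hemi_face :=
  fun x y => val x \subset val y.

(* The hemi-dodecahedron is the dual of the hemi-icosahedron. *)
Definition hemi_dodecahedron : rel hemi_face :=
  fun x y => val y \subset val x.

(* These properties determine the polytope up to isomorphism: a regular
   4-polytope with hemi-icosahedral facets and hemi-dodecahedral vertex-figures
   is a quotient of the universal one, whose group is the simple group PSL_2(11).
   The facets have group <rho_0, rho_1, rho_2>, the vertex-figures have group
   <rho_1, rho_2, rho_3>. *)
Definition is_eleven_cell (gT : finGroupType) (G : {group gT})
    (rho : seq gT) : Prop :=
  [/\ string_C_group G rho,
      size rho = 4,
      schlafli_type rho = [:: 3; 5; 3],
      self_dual G rho
    & [/\ is_string_group_of hemi_icosahedron
            <<[set x in take 3 rho]>>%G (take 3 rho),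
          is_string_group_of hemi_dodecahedron
            <<[set x in drop 1%N rho]>>%G (drop 1%N rho)
        & G \isog PSL 2 'F_11]].

Definition perm_rep_edge (n : nat) (rho : seq 'S_n) (i : nat) (a b : 'I_n) :
    bool :=
  (nth 1 rho i a == b) && (a != b).

(* E lists, for every label i, the i-edges between the names 1, ..., n; the
   point a of 'I_n gets the name (v a).+1. *)
Definition has_perm_rep_graph (n : nat) (rho : seq 'S_n)
    (E : seq (seq (nat * nat))) : Prop :=
  size rho = size E /\
  exists v : 'S_n, forall (i : 'I_(size rho)) (a b : 'I_n),
    perm_rep_edge rho i a b =
      (((v a).+1, (v b).+1) \in nth [::] E i) ||
      (((v b).+1, (v a).+1) \in nth [::] E i).

Definition eleven_cell_graph : seq (seq (nat * nat)) :=
  [:: [:: (1%N, 2); (5, 6); (8, 9); (10, 11)];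
      [:: (2, 3); (4, 5); (7, 8); (10, 11)];
      [:: (3, 4); (5, 6); (8, 10); (9, 11)];
      [:: (4, 7); (5, 8); (6, 9); (10, 11)]].

(* Main.v *)
(** The order of G divides 660, hence the commuting involutions rho_0 and rho_2
    generate a Sylow 2-subgroup. So the rank is not 5, since rho_0, rho_2, rho_4
    would generate a group of order 8, and g^330 = 1 for all g in G.

    By transitivity G contains an 11-cycle, which we may take to be x |-> x + 1
    on Z/11. An even involution t fixes two points, and since the affine group
    normalises the 11-cycle and is 2-transitive, we may take them to be 0 and 1.
    Requiring that the words in t and the 11-cycle have order dividing 330 leaves
    six candidates for t, all of them affine conjugates of a single involution
    t0. So every involution of G is one of the 110 affine conjugates of t0; with
    rho_0 = t0 the commutation relations leave few quadruples, and in those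
    compatible with transitivity and the intersection property either rho or its
    reverse is the sequence read off the graph, up to renaming the points.

    For that sequence, the self-duality comes from the 11 blocks of a biplane on
    the 11 points, on which rho_i acts as rho_{3-i} does on the points; and the
    facet group acts on six points as the group of the hemi-icosahedron on its
    six vertices. The vertex-figures are handled by duality. *)
Require Import Defs.
From HB Require Import structures.
From mathcomp Require Import all_boot all_order all_algebra.
From mathcomp Require Import all_fingroup all_solvable.
Import GroupScope.

Set Implicit Arguments.
Unset Strict Implicit.
Unset Printing Implicit Defensive.

(** * The order of PSL_2(11) *)

Lemma card_SL2 (F : finFieldType) : (#|SL 2 F| * #|F|.-1)%N = #|'GL_2[F]|.
Proof.
pose d (a : F) : 'M[F]_2 := diag_mx (\row_i if i == ord0 then a else 1%R).
have det_d a : (\det (d a) = a)%R.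
  by rewrite det_diag big_ord_recl big_ord1 !mxE GRing.mulr1.
have unit_d a : a != 0%R -> d a \is a GRing.unit.
  by move=> a0; rewrite -[_ \is a _]/(d a \in unitmx) unitmxE det_d GRing.unitfE.
rewrite -[RHS]sum1_card.
(* The fibre of the determinant over [a] is the coset of SL_2 by diag(a, 1). *)
rewrite (partition_big (fun A => \det (GLval A))%R (predC1 0%R)) => [|A _];
  last exact: GL_det.
have -> : #|F|.-1 = #|predC1 (0%R : F)| by rewrite cardC1.
rewrite mulnC -sum_nat_const; apply: eq_bigr => a; rewrite inE => a0.
rewrite sum1dep_card; pose D : {'GL_2[F]} := FinRing.unit _ (unit_d a a0).
rewrite -(card_lcoset _ D); apply: eq_card => A.
rewrite mem_lcoset !inE GL_ME GL_VE det_mulmx detV.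
rewrite [(\det (GLval D))%R]det_d; apply/eqP/eqP => [|->]; last by rewrite GRing.mulVf.
by move/(congr1 (GRing.mul a)); rewrite GRing.mulVKf // GRing.mulr1.
Qed.

(** SL_2(11) has order 1320, and the central involution -1 makes the order of its centre even. *)
Lemma dvdn_card_PSL2_11 : #|PSL 2 'F_11| %| 660.
Proof.
have cSL : #|SL 2 'F_11| = 1320.
  apply/eqP; rewrite -(eqn_pmul2r (isT : 0 < 10)); apply/eqP.
  by have := card_SL2 'F_11; rewrite card_GL_2 card_Fp.
have unitN1 : (-1 : 'M['F_11]_2)%R \is a GRing.unit by rewrite GRing.unitrN1.
pose m := FinRing.unit _ unitN1 : {'GL_2['F_11]}.
have m1 : m != 1 by apply/eqP => /(congr1 val)/matrixP/(_ 0%R 0%R); rewrite !mxE.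
have mm : m ^+ 2 = 1 by apply: val_inj; rewrite /= GRing.mulrNN GRing.mulr1.
have mZ : m \in 'Z(SL 2 'F_11).
  apply/centerP; split=> [|A _].
    by rewrite inE /= -GRing.scaleN1r detZ det1 GRing.mulr1 GRing.sqrrN GRing.expr1n.
  by apply: val_inj; rewrite /= GRing.mulN1r GRing.mulrN1.
have Z2 : 2 %| #|'Z(SL 2 'F_11)|.
  by have := order_dvdG mZ; rewrite (nt_prime_order (isT : prime 2) mm m1).
have := Lagrange (center_sub [group of SL 2 'F_11]).
rewrite -(card_quotient (normal_norm (center_normal _))) [LHS]/= cSL => eq1320.
rewrite -(dvdn_pmul2l (isT : 0 < 2)) -[(2 * 660)%N]/1320 -[X in _ %| X]eq1320.
by rewrite dvdn_mul.
Qed.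

(** * Permutations as tables of values *)

Definition tab n (s : 'S_n) : seq nat := [seq (s i : nat) | i <- enum 'I_n].
(** The left factor acts first, as in [permM]. *)
Definition tab_mul (p q : seq nat) := [seq nth 0 q x | x <- p].
Definition is_tab n (l : seq nat) := [&& size l == n, uniq l & all (gtn n) l].
(** The lock keeps conversion from unfolding the search through the symmetric group. *)
HB.lock Definition perm_of_tab n (l : seq nat) : 'S_n :=
  odflt 1 [pick s | tab s == l].

Section Tab.
Variable n : nat.
Implicit Types s t : 'S_n.

Lemma size_tab s : size (tab s) = n.
Proof. by rewrite size_map size_enum_ord. Qed.

Lemma nth_tab s (i : 'I_n) : nth 0 (tab s) i = s i.
Proof. by rewrite (nth_map i) ?size_enum_ord // nth_ord_enum. Qed.

Lemma tab_inj : injective (@tab n).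
Proof.
by move=> s t eq_st; apply/permP=> i; apply: ord_inj; rewrite -!nth_tab eq_st.
Qed.

Lemma tab1 : tab (1 : 'S_n) = iota 0 n.
Proof. by rewrite -val_enum_ord; apply: eq_map => i; rewrite perm1. Qed.

Lemma tabM s t : tab (s * t) = tab_mul (tab s) (tab t).
Proof.
by rewrite /tab_mul -map_comp; apply: eq_map => i; rewrite /= permM nth_tab.
Qed.

Lemma tabP s (l : seq nat) :
  size l = n -> (forall i : 'I_n, s i = nth 0 l i :> nat) -> tab s = l.
Proof.
move=> sz_l eq_sl; apply: (@eq_from_nth _ 0) => [|i]; rewrite size_tab // => lt_i.
by rewrite (nth_tab s (Ordinal lt_i)) eq_sl.
Qed.

Lemma is_tab_tab s : is_tab n (tab s).
Proof.
apply/and3P; split; first by rewrite size_tab.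
  by rewrite map_inj_uniq ?enum_uniq // => i j /val_inj/perm_inj.
by apply/allP=> _ /mapP[i _ ->] /=.
Qed.

Lemma tab_perm_of l : is_tab n l -> tab (perm_of_tab n l) = l.
Proof.
case/and3P=> /eqP sz_l uniq_l /allP lt_l; rewrite perm_of_tab.unlock.
case: pickP => [s /eqP//|/=].
have lt_nth (i : 'I_n) : nth 0 l i < n by apply/lt_l/mem_nth; rewrite sz_l.
pose f i := Ordinal (lt_nth i).
have f_inj : injective f.
  move=> i j /(congr1 val)/eqP /=; rewrite nth_uniq ?sz_l // => /eqP.
  exact: val_inj.
by move/(_ (perm f_inj))/eqP=> []; apply: tabP => // i; rewrite permE.
Qed.

Lemma perm_of_tabE l (i : 'I_n) : is_tab n l -> perm_of_tab n l i = nth 0 l i :> nat.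
Proof. by move=> /tab_perm_of{2}<-; rewrite nth_tab. Qed.

End Tab.

Lemma all_ordP n (P : pred nat) : reflect (forall i : 'I_n, P i) (all P (iota 0 n)).
Proof.
apply: (iffP allP) => [P_n i | P_n i]; first by apply: P_n; rewrite mem_iota /=.
by rewrite mem_iota /= => lt_in; apply: (P_n (Ordinal lt_in)).
Qed.

Lemma all_iota_ord n (P : pred nat) (i : 'I_n) : all P (iota 0 n) -> P i.
Proof. by move/all_ordP. Qed.

Lemma all_iota n (P : pred nat) i : all P (iota 0 n) -> i < n -> P i.
Proof. by move=> P_n lt_i; apply: (all_iota_ord (Ordinal lt_i) P_n). Qed.

(** * Generating sequences with the same relations *)

(* An index outside the sequence contributes the factor 1. *)
Definition word (gT : finGroupType) (s : seq gT) (w : seq nat) : gT :=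
  \prod_(i <- w) nth 1 s i.

(** Inverses in a finite group are powers, so positive words suffice to express that matching the
    generators gives an isomorphism of the generated groups. *)
Definition same_rel (gT hT : finGroupType) (s : seq gT) (t : seq hT) : Prop :=
  size s = size t /\ forall w, (word s w == 1) = (word t w == 1).

Section Words.
Variables (gT : finGroupType) (s : seq gT).

Lemma word_cat w w' : word s (w ++ w') = word s w * word s w'.
Proof. exact: big_cat. Qed.

Lemma word_nseq k w : word s (flatten (nseq k w)) = word s w ^+ k.
Proof.
by elim: k => [|k IHk]; [apply: big_nil | rewrite /= word_cat IHk expgS].
Qed.

Lemma word1 i : word s [:: i] = nth 1 s i.
Proof. exact: big_seq1. Qed.

Lemma mem_word w : word s w \in <<[set x in s]>>.
Proof.
apply: group_prod => i _; have [lt_i|le_i] := ltnP i (size s).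
  by rewrite mem_gen // inE mem_nth.
by rewrite nth_default ?group1.
Qed.

Lemma gen_word g : g \in <<[set x in s]>> -> exists w, g = word s w.
Proof.
case/gen_prodgP=> n [c c_s ->]; exists [seq index (c i) s | i <- index_enum 'I_n].
rewrite /word big_map; apply: eq_bigr => i _.
by rewrite nth_index //; have := c_s i; rewrite inE.
Qed.

Lemma word_take k w : word (take k s) w = word s [seq i <- w | i < k].
Proof.
rewrite /word big_filter [RHS]big_mkcond; apply: eq_bigr => i _.
case: ltnP => [lt_ik | le_ki]; first by rewrite nth_take.
by rewrite nth_default // size_take_min geq_min le_ki.
Qed.

Lemma word_rev w :
  word (rev s) w = word s [seq size s - i.+1 | i <- w & i < size s].
Proof.
rewrite /word big_map big_filter [RHS]big_mkcond; apply: eq_bigr => i _.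
by case: ltnP => [lt_i | le_i]; [rewrite nth_rev | rewrite nth_default ?size_rev].
Qed.

Lemma word_map_conj u w : word [seq x ^ u | x <- s] w = word s w ^ u.
Proof.
rewrite /word (big_morph (conjg^~ u) (fun x y => conjMg x y u) (conj1g u)).
apply: eq_bigr => i _; have [lt_i|le_i] := ltnP i (size s).
  by rewrite (nth_map 1).
by rewrite !nth_default ?size_map // conj1g.
Qed.

End Words.

Section SameRel.
Variables gT hT : finGroupType.
Implicit Types (s : seq gT) (t : seq hT).

Lemma same_rel_sym s t : same_rel s t -> same_rel t s.
Proof. by case=> sz st; split=> // w; rewrite st. Qed.

Lemma same_rel_trans (kT : finGroupType) s t (r : seq kT) :
  same_rel s t -> same_rel t r -> same_rel s r.
Proof. by case=> sz_st st [sz_tr tr]; split=> [|w]; [rewrite sz_st | rewrite st]. Qed.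

Lemma same_rel_take k s t : same_rel s t -> same_rel (take k s) (take k t).
Proof.
by case=> sz st; split=> [|w]; [rewrite !size_take_min sz | rewrite !word_take].
Qed.

Lemma same_rel_rev s t : same_rel s t -> same_rel (rev s) (rev t).
Proof. by case=> sz st; split=> [|w]; [rewrite !size_rev | rewrite !word_rev sz]. Qed.

Lemma same_rel_conj s u : same_rel s [seq x ^ u | x <- s].
Proof.
split=> [|w]; first by rewrite size_map.
by rewrite word_map_conj conjg_eq1.
Qed.

Lemma same_rel_word s t w w' :
  same_rel s t -> word s w = word s w' -> word t w = word t w'.
Proof.
(* The exponent [m] kills [w'] in both groups, so [w'] repeated m - 1 times is a word for the
   inverse on both sides. *)
case=> _ st eq_s; pose m := (#[word s w'] * #[word t w'])%N.
have m_gt0 : 0 < m by rewrite muln_gt0 !order_gt0.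
have invw (rT : finGroupType) (r : seq rT) : word r w' ^+ m = 1 -> 
    word r (flatten (nseq m.-1 w')) = (word r w')^-1.
  move=> r1; apply/eqP; rewrite word_nseq eq_sym eq_invg_mul -expgS prednK //.
  exact/eqP.
have := st (w ++ flatten (nseq m.-1 w')); rewrite !word_cat !invw.
- by rewrite eq_s mulgV eqxx -eq_mulgV1 => /esym/eqP.
- by rewrite /m mulnC expgM expg_order expg1n.
- by rewrite expgM expg_order expg1n.
Qed.

End SameRel.

(** An element goes to the value in [t] of any word for it in [s]; by [same_rel_word] the choice of
    the word does not matter. *)
Lemma same_rel_morphism (gT hT : finGroupType) (s : seq gT) (t : seq hT) :
    same_rel s t ->
  exists f : {morphism <<[set x in s]>> >-> hT},
    [/\ 'injm f, f @* <<[set x in s]>> = <<[set x in t]>>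
      & forall w, f (word s w) = word t w].
Proof.
move=> st; pose P g h := forall w, g = word s w -> h = word t w.
have [f fP] : exists f : gT -> hT, forall g, g \in <<[set x in s]>> -> P g (f g).
  apply: (@fin_all_exists gT (fun=> hT) (fun g h => g \in _ -> P g h)) => g.
  have [/gen_word[w ->]|_] := boolP (g \in _); last by exists 1.
  by exists (word t w) => _ w'; apply: same_rel_word.
have fw w : f (word s w) = word t w by apply: fP; rewrite ?mem_word.
have fM : {in <<[set x in s]>> &, {morph f : x y / x * y}}.
  by move=> _ _ /gen_word[w ->] /gen_word[w' ->]; rewrite -word_cat !fw word_cat.
exists (Morphism fM); split=> [||w]; last exact: fw.
  apply/injmP=> _ _ /gen_word[w ->] /gen_word[w' ->]; rewrite /= !fw.
  exact: same_rel_word (same_rel_sym st).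
apply/setP=> h; apply/morphimP/idP => [[_ _ /gen_word[w ->] ->] | /gen_word[w ->]].
  by rewrite /= fw mem_word.
by exists (word s w); rewrite ?mem_word //= fw.
Qed.

(** * Two permutation representations linked by an invariant relation *)

Section Incidence.

Variables (T1 T2 : finType) (R : T1 -> T2 -> T2 -> bool).
Hypothesis R_sepl : forall x x', (forall y z, R x y z = R x' y z) -> x = x'.
Hypothesis R_sepr : forall y y', (forall x, R x y y = R x y' y') -> y = y'.

(* R is invariant under all pairs of words, so where one word of a pair is
   trivial the other one fixes everything that R can distinguish. *)
Lemma same_rel_incidence (s : seq {perm T1}) (t : seq {perm T2}) :
    size s = size t ->
    (forall i x y z, i < size s ->
       R (nth 1 s i x) (nth 1 t i y) (nth 1 t i z) = R x y z) ->
  same_rel s t.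
Proof.
move=> sz inv; split=> // w.
have inv_w x y z : R (word s w x) (word t w y) (word t w z) = R x y z.
  elim: w x y z => [|i w IHw] x y z; rewrite /word ?big_nil ?perm1 //.
  rewrite !big_cons !permM IHw; have [/inv//|le_i] := ltnP i (size s).
  by rewrite !nth_default -?sz // !perm1.
apply/eqP/eqP=> w1; apply/permP=> x; rewrite perm1.
  by apply: R_sepr => z; rewrite -[RHS](inv_w z x x) w1 perm1.
by apply: R_sepl => y z; rewrite -[RHS](inv_w x y z) w1 !perm1.
Qed.

End Incidence.

(** * Automorphisms of posets and string groups of polytopes *)

Lemma poset_autP (F : finType) (le : rel F) (s : {perm F}) :
  reflect (forall x y, le (s x) (s y) = le x y) (s \in poset_aut le).
Proof.
rewrite inE; apply: (iffP forallP) => [s_aut x y | s_aut x].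
  by have /forallP/(_ y)/eqP := s_aut x.
by apply/forallP=> y; rewrite s_aut.
Qed.

Lemma poset_aut_group_set (F : finType) (le : rel F) : group_set (poset_aut le).
Proof.
apply/group_setP; split=> [|s t /poset_autP s_aut /poset_autP t_aut].
  by apply/poset_autP=> x y; rewrite !perm1.
by apply/poset_autP=> x y; rewrite !permM t_aut s_aut.
Qed.

Canonical poset_aut_group (F : finType) (le : rel F) :=
  Group (poset_aut_group_set le).

(** With the flag as a plain sequence, no type depends on [size rho]. *)
Lemma string_group_ofP (F : finType) (le : rel F) (gT : finGroupType)
    (G : {group gT}) (rho : seq gT) :
  is_string_group_of le G rho <->
  exists (f : {morphism G >-> {perm F}}) (phi : seq F),
    [/\ isom G (poset_aut le) f, is_flag le phi, size phi = size rho
      & forall x0 i j, i < size rho -> j < size rho ->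
          (f (nth 1 rho i) (nth x0 phi j) == nth x0 phi j) = (i != j)].
Proof.
split=> [[f [phi [isof flag fix_phi]]] | [f [phi [isof flag sz_phi fix_phi]]]].
  exists f, phi; split=> //; first by rewrite size_tuple.
  move=> x0 i j lt_i lt_j.
  by have := fix_phi (Ordinal lt_i) (Ordinal lt_j); rewrite (tnth_nth x0).
exists f, (Tuple (introT eqP sz_phi)); split=> // i j.
by rewrite (tnth_nth (tnth (Tuple (introT eqP sz_phi)) j)) /= fix_phi.
Qed.

(** The dual poset has the same automorphisms, and its flags are read backwards. *)
Lemma string_group_of_rev (F : finType) (le : rel F) (gT : finGroupType)
    (G : {group gT}) (rho : seq gT) :
  is_string_group_of le G rho ->
  is_string_group_of (fun x y => le y x) G (rev rho).
Proof.
case/string_group_ofP=> f [phi [isof [sorted_phi max_phi] sz_phi fix_phi]].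
apply/string_group_ofP; exists f, (rev phi); split.
- suff -> : poset_aut (fun x y => le y x) = poset_aut le by [].
  by apply/setP=> s; apply/poset_autP/poset_autP.
- split=> [|x x_phi].
    by rewrite rev_sorted; apply: sub_sorted sorted_phi => x y /=; rewrite eq_sym.
  rewrite mem_rev; apply: max_phi => y.
  by rewrite orbC -mem_rev; apply: x_phi.
- by rewrite !size_rev.
move=> x0 i j; rewrite size_rev => lt_i lt_j.
have lt_sub k : size rho - k.+1 < size rho.
  by rewrite ltn_subrL (leq_ltn_trans _ lt_i).
by rewrite !nth_rev ?sz_phi // fix_phi // eqn_sub2lE // eqSS.
Qed.

Lemma same_rel_string_group_of (F : finType) (le : rel F)
    (gT hT : finGroupType) (s : seq gT) (t : seq hT) :
    same_rel s t ->
  is_string_group_of le <<[set x in s]>>%G s ->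
  is_string_group_of le <<[set x in t]>>%G t.
Proof.
move=> st /string_group_ofP[f [phi [/isomP[injf imf] flag sz_phi fix_phi]]].
have [g [injg img gw]] := same_rel_morphism (same_rel_sym st).
have mem_g x : x \in <<[set x in t]>> -> g x \in <<[set x in s]>>.
  by move=> tx; rewrite -img mem_morphim.
have gM : {in <<[set x in t]>> &, {morph f \o g : x y / x * y}}.
  by move=> x y tx ty; rewrite /= !morphM // mem_g.
apply/string_group_ofP; exists (Morphism gM), phi; split=> //.
- apply/isomP; split.
    apply/injmP=> x y tx ty /= /(injmP injf) eq_g.
    by apply: (injmP injg) => //; apply: eq_g; apply: mem_g.
  rewrite -imf; apply/setP=> h; apply/morphimP/morphimP.
    by case=> x tx _ ->; exists (g x); rewrite // mem_g.
  case=> y _ sy ->; have /morphimP[x tx _ ->] : y \in g @* <<[set x in t]>>.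
    by rewrite img.
  by exists x.
- by rewrite sz_phi st.1.
move=> x0 i j; rewrite -st.1 => lt_i lt_j.
by rewrite -(fix_phi x0) // -!word1 /= gw.
Qed.

(** * The hemi-icosahedron *)

(** Sets of axes given by lists, so that statements about them become computations. *)
Definition axis_set (l : seq nat) : {set 'I_6} := [set x : 'I_6 | val x \in l].

Lemma eq_axis_set l l' :
  (axis_set l == axis_set l')
  = all (fun x => (x \in l) == (x \in l')) (iota 0 6).
Proof.
apply/eqP/all_ordP => [/setP eq_l x | eq_l].
  by have := eq_l x; rewrite !inE => ->.
by apply/setP=> x; rewrite !inE; apply/eqP/eq_l.
Qed.

Lemma sub_axis_set l l' :
  (axis_set l \subset axis_set l')
  = all (fun x => (x \in l) ==> (x \in l')) (iota 0 6).
Proof.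
apply/subsetP/all_ordP => [sub_l x | sub_l x]; last first.
  by rewrite !inE; apply/implyP/sub_l.
by apply/implyP; have := sub_l x; rewrite !inE.
Qed.

Lemma card_axis_set l : #|axis_set l| = size [seq x <- iota 0 6 | x \in l].
Proof.
rewrite -val_enum_ord filter_map size_map cardsE cardE {1}/enum_mem -enumT.
by congr (size _); apply: eq_filter.
Qed.

Lemma imset_axis_set (p : 'S_6) l :
  all (gtn 6) l -> p @: axis_set l = axis_set (tab_mul l (tab p)).
Proof.
move/allP=> lt_l; apply/setP=> x; rewrite inE; apply/imsetP/mapP.
  case=> y; rewrite inE => l_y ->; exists (val y) => //.
  by rewrite nth_tab.
case=> k l_k x_k; exists (Ordinal (lt_l k l_k)); rewrite ?inE //.
by apply: ord_inj; rewrite [LHS]x_k -nth_tab.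
Qed.

Definition triangles : seq (seq nat) :=
  flatten [seq [:: [:: 5; i; i.+1 %% 5]; [:: i; i.+1 %% 5; (i + 3) %% 5]]
             | i <- iota 0 5].

Lemma eq_axis (x : 'I_6) k : (x == axis k) = (val x == k %% 5).
Proof. by rewrite -val_eqE /= inordK // ltnW // ltnS ltn_mod. Qed.

Lemma triangle_axis_set S :
  hemi_icosahedron_triangle S = has (fun l => S == axis_set l) triangles.
Proof.
have e1 (i : 'I_5) : [set ord_max; axis i; axis i.+1]
    = axis_set [:: 5; val i; i.+1 %% 5].
  by apply/setP=> x; rewrite !inE !eq_axis modn_small ?orbA.
have e2 (i : 'I_5) : [set axis i; axis i.+1; axis (i + 3)]
    = axis_set [:: val i; i.+1 %% 5; (i + 3) %% 5].
  by apply/setP=> x; rewrite !inE !eq_axis (modn_small (ltn_ord i)) orbA.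
apply/existsP/hasP => [[i]|[l /flatten_mapP[k]]].
  rewrite e1 e2 => /orP eqS; have i5 : val i \in iota 0 5 by rewrite mem_iota /=.
  case: eqS => /eqP->; eexists; rewrite ?eqxx //; apply/flatten_mapP;
    by exists (val i); rewrite // !inE eqxx ?orbT.
rewrite mem_iota /= => lt_k; rewrite !inE => l_k eqS; exists (Ordinal lt_k).
by rewrite e1 e2 /=; case/orP: l_k eqS => /eqP-> ->; rewrite ?orbT.
Qed.

Lemma card_triangle S : hemi_icosahedron_triangle S -> #|S| = 3.
Proof.
rewrite triangle_axis_set => /hasP[l l_tri /eqP->]; rewrite card_axis_set.
have check : all (fun l => size [seq x <- iota 0 6 | x \in l] == 3) triangles.
  by [].
exact/eqP/(allP check).
Qed.

Lemma triangle_face S :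
  hemi_icosahedron_face S -> #|S| = 3 -> hemi_icosahedron_triangle S.
Proof. by rewrite /hemi_icosahedron_face => + oS; rewrite oS. Qed.

Definition preserves_faces (p : 'S_6) :=
  forall S, hemi_icosahedron_face S -> hemi_icosahedron_face (p @: S).

Definition preserves_triangles (l : seq nat) :=
  all (fun T => has (fun T' =>
    all (fun x => (x \in tab_mul T l) == (x \in T')) (iota 0 6))
  triangles) triangles.

(** Permutations preserve cardinality and all sets of size 1 or 2 are faces, so only the triangles,
    the faces of size 3, matter. *)
Lemma preserves_facesP p : preserves_faces p <-> preserves_triangles (tab p).
Proof.
have lt6 T : T \in triangles -> all (gtn 6) T.
  exact: (allP (isT : all (all (gtn 6)) triangles)).
split=> [p_faces | p_tri S].
  apply/allP=> T tT; have tri_T : hemi_icosahedron_triangle (axis_set T).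
    by rewrite triangle_axis_set; apply/hasP; exists T.
  have: hemi_icosahedron_triangle (p @: axis_set T).
    apply: triangle_face.
      by apply: p_faces; rewrite /hemi_icosahedron_face tri_T !orbT.
    by rewrite card_imset ?card_triangle //; apply: perm_inj.
  rewrite triangle_axis_set imset_axis_set ?lt6 // => /hasP[T' tT' eqT].
  by apply/hasP; exists T' => //; rewrite -eq_axis_set.
rewrite /hemi_icosahedron_face card_imset; last exact: perm_inj.
case: (_ == _) => //; case: (_ == _) => //=; rewrite !triangle_axis_set.
case/hasP=> T tT /eqP->; rewrite imset_axis_set ?lt6 //.
case/hasP: (allP p_tri T tT) => T' tT' eqT; apply/hasP; exists T' => //.
by rewrite eq_axis_set.
Qed.

Definition face_perm (p : 'S_6) : {perm hemi_face} :=
  odflt 1 [pick h : {perm hemi_face} | [forall F, val (h F) == p @: val F]].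

Lemma face_permE p F : preserves_faces p -> val (face_perm p F) = p @: val F.
Proof.
move=> p_faces; rewrite /face_perm; case: pickP => [h /forallP/(_ F)/eqP // | /= none].
pose f (F : hemi_face) : hemi_face := Sub (p @: val F) (p_faces _ (valP F)).
have f_inj : injective f.
  by move=> F1 F2 /(congr1 val)/= /(imset_inj perm_inj) /val_inj.
by case/forallP: (none (perm f_inj)) => F'; rewrite permE.
Qed.

(* The reflections that change one face of the flag hemi_flag below. *)
Definition hemi_tabs : seq (seq nat) :=
  [:: [:: 5; 1; 3; 2; 4; 0]; [:: 1; 0; 4; 3; 2; 5]; [:: 0; 4; 3; 2; 1; 5]]%N.
Definition hemi_perms : seq 'S_6 := [seq perm_of_tab 6 l | l <- hemi_tabs].
Definition hemi_faces : seq {perm hemi_face} := [seq face_perm p | p <- hemi_perms].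

Lemma tab_hemi_perms p : p \in hemi_perms -> tab p \in hemi_tabs.
Proof.
case/mapP=> l l_hemi ->; rewrite tab_perm_of //.
exact: (allP (isT : all (is_tab 6) hemi_tabs)).
Qed.

Lemma hemi_permsE i (x : 'I_6) :
  i < 3 -> nth 1 hemi_perms i x = nth 0 (nth [::] hemi_tabs i) x :> nat.
Proof.
move=> lt_i; rewrite (nth_map [::]) // perm_of_tabE //.
by apply/(allP (isT : all (is_tab 6) hemi_tabs))/mem_nth.
Qed.

Lemma preserves_faces_hemi p : p \in hemi_perms -> preserves_faces p.
Proof.
move/tab_hemi_perms=> p_hemi; apply/preserves_facesP.
exact: (allP (isT : all preserves_triangles hemi_tabs)).
Qed.

Lemma word_hemi_faces w F : val (word hemi_faces w F) = word hemi_perms w @: val F.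
Proof.
elim: w F => [|i w IHw] F.
  rewrite /word !big_nil perm1 -[LHS]imset_id.
  by apply: eq_imset => x; rewrite perm1.
rewrite /word !big_cons permM [LHS]IHw.
have [lt_i|le_i] := ltnP i (size hemi_perms); last first.
  by rewrite !nth_default // perm1 mul1g.
rewrite (nth_map 1) // face_permE; last exact/preserves_faces_hemi/mem_nth.
by rewrite -imset_comp; apply: eq_imset => x; rewrite permM.
Qed.

Definition vertex (x : 'I_6) : hemi_face :=
  Sub [set x] (introT or3P (Or31 _ _ (introT eqP (cards1 x)))).

(** Faces are sets of axes and every single axis is a face, so a word fixes all faces exactly when
    it fixes all axes. *)
Lemma same_rel_hemi_faces : same_rel hemi_perms hemi_faces.
Proof.
split=> [|w]; first by rewrite size_map.
apply/eqP/eqP=> w1; apply/permP=> x; rewrite perm1.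
  apply: val_inj; rewrite word_hemi_faces w1 -[RHS]imset_id.
  by apply: eq_imset => y; rewrite perm1.
by have := word_hemi_faces w (vertex x); rewrite w1 perm1 imset_set1 => /set1_inj.
Qed.

(** Sixteen rounds suffice: the group is a quotient of the Coxeter group H_3, whose longest element
    has length 15. *)
Definition hemi_group_tabs : seq (seq nat) :=
  iter 16 (fun L => undup (L ++ [seq tab_mul l g | l <- L, g <- hemi_tabs]))
    [:: iota 0 6].

Lemma hemi_group_word l :
  l \in hemi_group_tabs -> exists w, l = tab (word hemi_perms w).
Proof.
rewrite /hemi_group_tabs; elim: 16 l => [|k IHk] l.
  by rewrite inE => /eqP->; exists [::]; rewrite /word big_nil tab1.
rewrite iterS mem_undup mem_cat => /orP[/IHk //|].
case/allpairsP=> -[l' g] /= [/IHk[w ->] hemi_g ->].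
exists (w ++ [:: index g hemi_tabs]); rewrite word_cat word1 tabM.
rewrite (nth_map [::]) ?index_mem // nth_index // tab_perm_of //.
by apply: (allP (isT : all (is_tab 6) hemi_tabs)).
Qed.

Lemma hemi_group_check :
  all (fun l => preserves_triangles l ==> (l \in hemi_group_tabs))
    (permutations (iota 0 6)).
Proof. by vm_compute. Qed.

Lemma preserves_faces_word p :
  preserves_faces p -> exists w, p = word hemi_perms w.
Proof.
move/preserves_facesP=> p_tri; have [] := @hemi_group_word (tab p); last first.
  by move=> w /tab_inj->; exists w.
apply: (implyP (allP hemi_group_check _ _)) p_tri.
rewrite mem_permutations; have /and3P[/eqP sz_p uniq_p /allP lt_p] := is_tab_tab p.
rewrite uniq_perm ?iota_uniq //.
have [] := uniq_min_size uniq_p (s2 := iota 0 6) => // [x /lt_p|].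
  by rewrite mem_iota.
by rewrite size_iota sz_p.
Qed.

Lemma poset_aut_hemi_sub :
  <<[set h in hemi_faces]>> \subset poset_aut hemi_icosahedron.
Proof.
rewrite gen_subG; apply/subsetP=> h; rewrite inE => /mapP[p hemi_p ->].
have p_faces := preserves_faces_hemi hemi_p.
apply/poset_autP=> x y; rewrite /hemi_icosahedron !face_permE //.
apply/idP/idP => /subsetP xy; apply/subsetP=> a; last first.
  by case/imsetP=> b /xy yb ->; apply: imset_f.
by move=> xa; have := xy _ (imset_f p xa); rewrite (mem_imset _ _ perm_inj).
Qed.

(* An automorphism is determined by its action on the vertices, and the
   permutations of the six vertices that preserve the triangles are listed by
   hemi_group_check. *)
Lemma sub_poset_aut_hemi :
  poset_aut hemi_icosahedron \subset <<[set h in hemi_faces]>>.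
Proof.
apply/subsetP=> s /poset_autP s_aut; rewrite /hemi_icosahedron in s_aut.
have vtx y : exists x, val (s (vertex y)) == [set x].
  pose z := vertex y; have /set0Pn[x s_x] : val (s z) != set0.
    have [y' y'y] : exists y' : 'I_6, y != y'.
      by have [->|] := eqVneq y ord0; [exists ord_max | exists ord0].
    apply/eqP=> s0; have := s_aut z (vertex y').
    by rewrite s0 sub0set sub1set inE (negPf y'y).
  (* The vertex [x] lies below the image of [z], so its preimage is a nonempty face below the vertex
     [z], hence [z] itself. *)
  exists x; have eq_z : s^-1 (vertex x) = z.
    apply: val_inj; have := s_aut (s^-1 (vertex x)) z.
    rewrite permKV sub1set s_x => /esym.
    rewrite subset1 => /orP[/eqP // | /eqP e0].
    have := valP (s^-1 (vertex x)); rewrite e0 /hemi_icosahedron_face cards0 /=.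
    by move/card_triangle; rewrite cards0.
  by rewrite -/z -eq_z permKV.
pose p y := xchoose (vtx y).
have val_p y : val (s (vertex y)) = [set p y] by apply/eqP/(xchooseP (vtx y)).
have p_inj : injective p.
  move=> x y eq_p; have: s (vertex x) = s (vertex y).
    by apply: val_inj; rewrite !val_p eq_p.
  by move/perm_inj/(congr1 val)/set1_inj.
have val_s (F : hemi_face) : perm p_inj @: val F = val (s F).
  apply/setP=> x; rewrite -[x](permKV (perm p_inj)) (mem_imset _ _ perm_inj).
  by rewrite -sub1set -(s_aut (vertex _)) val_p sub1set permE.
have [|w pw] := @preserves_faces_word (perm p_inj).
  by move=> S faceS; have -> := val_s (Sub S faceS); apply: valP.
suff -> : s = word hemi_faces w by apply: mem_word.
by apply/permP=> F; apply: val_inj; rewrite word_hemi_faces -pw val_s.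
Qed.

Definition face_of (l : seq nat) : hemi_face :=
  insubd (vertex ord0) (axis_set l).

Definition hemi_flag : seq (seq nat) := [:: [:: 5]; [:: 0; 5]; [:: 0; 1; 5]]%N.

Lemma card_hemi_face S : hemi_icosahedron_face S ->
  (#|S| == 1%N) || (#|S| == 2) || (#|S| == 3).
Proof. by case/or3P=> [->|->|/card_triangle->]; rewrite ?orbT. Qed.

Lemma face_ofE l : l \in hemi_flag -> val (face_of l) = axis_set l.
Proof.
rewrite !inE => l_flag; rewrite val_insubd; case: ifP => // /negP[].
rewrite /hemi_icosahedron_face card_axis_set triangle_axis_set.
case/or3P: l_flag => /eqP-> //; apply/or3P/Or33/hasP.
by exists [:: 5; 0; 1]%N => //; rewrite eq_axis_set.
Qed.

Lemma string_group_of_hemi :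
  is_string_group_of hemi_icosahedron <<[set p in hemi_perms]>>%G hemi_perms.
Proof.
apply: same_rel_string_group_of (same_rel_sym same_rel_hemi_faces) _.
apply/string_group_ofP; exists (idm_morphism _), [seq face_of l | l <- hemi_flag].
have flagE k : k < 3 -> val (nth (vertex ord0) [seq face_of l | l <- hemi_flag] k)
    = axis_set (nth [::] hemi_flag k).
  by move=> lt_k; rewrite (nth_map [::]) // face_ofE // mem_nth.
split=> //.
- apply/isomP; split; first exact: injm_idm.
  rewrite morphim_idm //; apply/eqP.
  by rewrite eqEsubset poset_aut_hemi_sub sub_poset_aut_hemi.
- split=> [|x x_flag].
    have lt_face l l' : l \in hemi_flag -> l' \in hemi_flag ->
        (face_of l != face_of l') && hemi_icosahedron (face_of l) (face_of l')
        = (axis_set l != axis_set l') && (axis_set l \subset axis_set l').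
      by move=> l_flag l'_flag; rewrite -val_eqE /hemi_icosahedron !face_ofE.
    by rewrite /= !lt_face // !eq_axis_set !sub_axis_set.
  (* A face has size 1, 2 or 3, like some member of the flag; being comparable to that member, it is
     equal to it. *)
  have /hasP[l l_flag o_l] : has (fun l => #|val x| == #|axis_set l|) hemi_flag.
    by rewrite /= !card_axis_set orbF orbA; apply: card_hemi_face (valP x).
  have fl : face_of l \in [seq face_of l | l <- hemi_flag] by apply: map_f.
  suff -> : x = face_of l by [].
  apply: val_inj; have := x_flag _ fl; rewrite /hemi_icosahedron face_ofE //.
  case/orP=> sub_x; last apply/esym; apply/eqP;
    by rewrite eqEcard sub_x (eqP o_l) leqnn.
move=> x0 i j; rewrite size_map => lt_i lt_j.
rewrite (set_nth_default (vertex ord0)) ?size_map //.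
rewrite -val_eqE (nth_map 1) // [X in X == _]face_permE; last first.
  exact/preserves_faces_hemi/mem_nth.
have j_flag : nth [::] hemi_flag j \in hemi_flag by rewrite mem_nth.
rewrite flagE // imset_axis_set; last first.
  exact: (allP (isT : all (all (gtn 6)) hemi_flag)).
rewrite (nth_map [::]) // tab_perm_of ?eq_axis_set; last first.
  by apply/(allP (isT : all (is_tab 6) hemi_tabs))/mem_nth.
clear j_flag; move: (lt_i : i < 3) (lt_j : j < 3).
by move: i j {lt_i lt_j} => [|[|[|i]]] [|[|[|j]]].
Qed.

(** * The 11-cell *)

(* The generators read off eleven_cell_graph, the point named k being k - 1. *)
Definition eleven_tabs : seq (seq nat) :=
  [:: [:: 1; 0; 2; 3; 5; 4; 6; 8; 7; 10; 9];
      [:: 0; 2; 1; 4; 3; 5; 7; 6; 8; 10; 9];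
      [:: 0; 1; 3; 2; 5; 4; 6; 9; 10; 7; 8];
      [:: 0; 1; 2; 6; 7; 8; 3; 4; 5; 10; 9]]%N.

Definition eleven : seq 'S_11 := [seq perm_of_tab 11 l | l <- eleven_tabs].

Lemma tab_eleven i : i < 4 -> tab (nth 1 eleven i) = nth [::] eleven_tabs i.
Proof.
move=> lt_i; rewrite (nth_map [::]) // tab_perm_of //.
by apply/(allP (isT : all (is_tab 11) eleven_tabs))/mem_nth.
Qed.

Lemma elevenE i (x : 'I_11) :
  i < 4 -> nth 1 eleven i x = nth 0 (nth [::] eleven_tabs i) x :> nat.
Proof. by move=> lt_i; rewrite -tab_eleven // nth_tab. Qed.

(* The points 6, ..., 10 form an orbit of <rho_0, rho_1, rho_2>; its images are
   the blocks of a biplane, numbered here in such a way that rho_i acts on the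
   blocks as rho_{3-i} acts on the points. *)
Definition blocks : seq (seq nat) :=
  [:: [:: 6; 7; 8; 9; 10]; [:: 3; 4; 5; 9; 10]; [:: 2; 4; 5; 7; 8];
      [:: 1; 3; 5; 6; 8]; [:: 1; 2; 4; 6; 10]; [:: 1; 2; 3; 7; 9];
      [:: 0; 3; 4; 6; 7]; [:: 0; 2; 5; 6; 9]; [:: 0; 2; 3; 8; 10];
      [:: 0; 1; 5; 7; 10]; [:: 0; 1; 4; 8; 9]]%N.

Definition incident (x y : nat) := x \in nth [::] blocks y.

Definition separates n m (f : nat -> nat -> bool) :=
  all (fun x => all (fun x' =>
    all (fun y => f x y == f x' y) (iota 0 m) ==> (x == x'))
  (iota 0 n)) (iota 0 n).

Lemma separatesP n m f (x x' : 'I_n) : separates n m f ->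
  (forall y : 'I_m, f x y = f x' y) -> x = x'.
Proof.
move=> sep_f eq_f; apply/val_inj/eqP/(implyP (all_iota_ord x' (all_iota_ord x sep_f))).
by apply/all_ordP=> y; rewrite eq_f.
Qed.

(** Incidence is invariant when [eleven] acts on the points and [rev eleven] on the blocks, and it
    separates points as well as blocks. *)
Lemma same_rel_eleven_rev : same_rel eleven (rev eleven).
Proof.
apply: (same_rel_incidence (R := fun x y _ : 'I_11 => incident x y)) => //.
- move=> x x' eq_x.
  apply: (@separatesP 11 11 incident _ _ _ (fun y => eq_x y y)).
  by vm_compute.
- move=> y y' eq_y.
  apply: (@separatesP 11 11 (fun y x => incident x y) _ _ _ eq_y).
  by vm_compute.
have check : all (fun i => all (fun x => all (fun y =>
   incident (nth 0 (nth [::] eleven_tabs i) x)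
     (nth 0 (nth [::] eleven_tabs (3 - i)) y)
     == incident x y) (iota 0 11)) (iota 0 11)) (iota 0 4) by vm_compute.
move=> i x y _ lt_i; rewrite nth_rev // !elevenE ?ltn_subrL //; apply/eqP.
exact: (all_iota_ord y (all_iota_ord x (all_iota check lt_i))).
Qed.

(* The orbits of <rho_0, rho_1, rho_2> are 0, ..., 5 and 6, ..., 10. A point of
   the first one stands for an axis, a point of the second one for a partition
   of the six axes into three pairs, written as the involution swapping them. *)
Definition hemi_points : seq nat := [:: 5; 0; 1; 4; 2; 3]%N.

Definition synthemes : seq (seq nat) :=
  [:: [:: 5; 4; 3; 2; 1; 0]; [:: 2; 5; 0; 4; 3; 1]; [:: 1; 0; 4; 5; 2; 3];
      [:: 3; 2; 1; 0; 5; 4]; [:: 4; 3; 5; 1; 0; 2]]%N.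

(** One ternary relation serves both orbits: a point of the first is related to its axis taken
    twice, a point of the second to the pairs that its involution swaps. *)
Definition axis_incident (x y z : nat) :=
  if x < 6 then (y == z) && (nth 0 hemi_points x == y)
  else nth 0 (nth [::] synthemes (x - 6)) y == z.

Lemma same_rel_eleven_hemi : same_rel (take 3 eleven) hemi_perms.
Proof.
pose R (x : 'I_11) (y z : 'I_6) := axis_incident x y z.
apply: (same_rel_incidence (R := R)) => //; rewrite /R.
(* A pair of axes is coded as one number below 36 to fit [separates]. *)
- move=> x x' eq_x; pose f x k := axis_incident x (k %/ 6) (k %% 6).
  apply: (@separatesP 11 36 f); last move=> k.
    by vm_compute.
  have lt_k : k %/ 6 < 6 by rewrite ltn_divLR.
  exact: eq_x (Ordinal lt_k) (Ordinal (ltn_pmod k (isT : 0 < 6))).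
- move=> y y' eq_y.
  apply: (@separatesP 6 11 (fun y x => axis_incident x y y) _ _ _ eq_y).
  by vm_compute.
have check : all (fun i => all (fun x => all (fun y => all (fun z =>
   axis_incident (nth 0 (nth [::] eleven_tabs i) x)
     (nth 0 (nth [::] hemi_tabs i) y) (nth 0 (nth [::] hemi_tabs i) z)
     == axis_incident x y z) (iota 0 6)) (iota 0 6)) (iota 0 11)) (iota 0 3).
  by vm_compute.
move=> i x y z lt_i; rewrite nth_take // !elevenE 1?ltnW // !hemi_permsE //; apply/eqP.
exact: (all_iota_ord z (all_iota_ord y (all_iota_ord x (all_iota check lt_i)))).
Qed.

Definition tab_word (n : nat) (L : seq (seq nat)) (w : seq nat) : seq nat :=
  foldr (fun i l => tab_mul (nth [::] L i) l) (iota 0 n) w.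

Lemma tab_wordE n (L : seq (seq nat)) w :
  all (is_tab n) L -> all (gtn (size L)) w ->
  tab (word [seq perm_of_tab n l | l <- L] w) = tab_word n L w.
Proof.
move=> L_tab; elim: w => [|i w IHw] /=; first by rewrite /word big_nil tab1.
case/andP=> lt_i /IHw <-; rewrite /word big_cons tabM.
rewrite (nth_map [::]) // tab_perm_of //.
exact/(allP L_tab)/mem_nth.
Qed.

Lemma same_rel_order (gT hT : finGroupType) (s : seq gT) (t : seq hT) w :
  same_rel s t -> #[word s w] = #[word t w].
Proof.
move=> st; apply/eqP; rewrite eqn_dvd !order_dvdn -!word_nseq.
by rewrite [X in X && _]st.2 -[X in _ && X]st.2 !word_nseq !expg_order !eqxx.
Qed.

Lemma schlafli_eleven : schlafli_type eleven = [:: 3; 5; 3].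
Proof.
have order_w w p : prime p -> all (gtn 4) w ->
  tab_word 11 eleven_tabs (flatten (nseq p w)) = iota 0 11 ->
  tab_word 11 eleven_tabs w != iota 0 11 -> #[word eleven w] = p.
  move=> p_pr w4 wp w1; apply: nt_prime_order => //.
    apply: tab_inj; rewrite -word_nseq tab_wordE // ?tab1 //=.
    by apply/allP=> i /flattenP[_ /nseqP[-> _]] /(allP w4).
  apply: contraNneq w1 => w1.
  by rewrite -tab_wordE // -[X in tab X]/(word eleven w) w1 tab1.
have -> : schlafli_type eleven
    = [seq #[word eleven [:: i; i.+1]] | i <- iota 0 3].
  by apply: eq_map => i; rewrite /word big_cons big_seq1.
by congr [:: _; _; _]; apply: order_w.
Qed.

(** The type, the duality and the actions on the hemi-polytopes depend only on the relations between
    the generators, so they transfer from [eleven]. *)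
Lemma is_eleven_cell_same_rel (gT : finGroupType) (G : {group gT})
    (rho : seq gT) :
  string_C_group G rho -> G \isog PSL 2 'F_11 -> same_rel rho eleven ->
  is_eleven_cell G rho.
Proof.
move=> CG isoG rho11; have rho_rev : same_rel rho (rev rho).
  apply: (same_rel_trans rho11); apply: (same_rel_trans same_rel_eleven_rev).
  exact: same_rel_rev (same_rel_sym rho11).
have sz_rho : size rho = 4 := rho11.1.
have facets tau : same_rel tau eleven ->
    is_string_group_of hemi_icosahedron
      <<[set x in take 3 tau]>>%G (take 3 tau).
  move=> tau11; apply: same_rel_string_group_of string_group_of_hemi.
  exact/same_rel_sym/(same_rel_trans _ same_rel_eleven_hemi)/same_rel_take.
split=> //.
- rewrite -schlafli_eleven /schlafli_type sz_rho; apply: eq_map => i.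
  by rewrite -!word1 -!word_cat; apply: same_rel_order.
- have [f [injf imf fw]] := same_rel_morphism rho_rev.
  have genG : G :=: <<[set x in rho]>> by case: CG => [[]].
  have rev_gen : <<[set x in rev rho]>> = <<[set x in rho]>>.
    by congr <<_>>; apply/setP=> x; rewrite !inE mem_rev.
  rewrite rev_gen in imf; exists (aut injf imf).
    by rewrite genG Aut_aut.
  apply: (@eq_from_nth _ 1) => [|i]; rewrite size_map ?size_rev // => lt_i.
  rewrite (nth_map 1) // autE; last by rewrite -word1 mem_word.
  by rewrite -!word1 fw.
split=> //; first exact: facets.
(* The vertex-figures of rho are dual to the facets of the dual of rho. *)
have -> : drop 1 rho = rev (take 3 (rev rho)).
  by rewrite take_rev revK sz_rho.
have -> : <<[set x in rev (take 3 (rev rho))]>>%G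
    = <<[set x in take 3 (rev rho)]>>%G.
  by congr <<_>>%G; apply/setP=> x; rewrite !inE mem_rev.
have rev11 : same_rel (rev rho) eleven.
  exact: same_rel_trans (same_rel_sym rho_rev) rho11.
have := string_group_of_rev (facets _ _ rev11).
exact.
Qed.

Lemma eleven_cell_graphE (rho : seq 'S_11) u :
  rho = [seq s ^ u | s <- eleven] -> has_perm_rep_graph rho eleven_cell_graph.
Proof.
(* Conjugation by [u] moves the point [x] to [u x], so names are read through [u^-1]. *)
move=> ->; split=> //; exists u^-1 => i a b.
have lt_i : i < 4 by case: i.
rewrite -[a](permKV u) -[b](permKV u); move: (u^-1 a) (u^-1 b) => x y.
rewrite /perm_rep_edge (nth_map 1) // permJ !permK !(inj_eq perm_inj).
rewrite -!val_eqE /= elevenE //; apply/eqP.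
have check : all (fun i => all (fun x => all (fun y =>
   ((nth 0 (nth [::] eleven_tabs i) x == y) && (x != y)) ==
   (((x.+1, y.+1) \in nth [::] eleven_cell_graph i)
        || ((y.+1, x.+1) \in nth [::] eleven_cell_graph i)))
   (iota 0 11)) (iota 0 11)) (iota 0 4) by vm_compute.
exact: (all_iota_ord y (all_iota_ord x (all_iota check lt_i))).
Qed.

(** * Involutions in the group *)

(* By the orbit-counting lemma for <t>, 11 plus the number of fixed points is
   twice the number of cycles of t, which is odd because t is even. *)
Lemma even_involution_fix2 (t : 'S_11) : t ^+ 2 = 1 -> t \in 'Alt_('I_11) ->
  exists a b, [/\ a != b, t a = a & t b = b].
Proof.
move=> tt; rewrite Alt_even => even_t.
pose F := [set x | t x == x].
suff /card_gt1P[a [b [Fa Fb ab]]] : 1 < #|F|.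
  by exists a, b; move: Fa Fb; rewrite !inE => /eqP-> /eqP->.
have [t1|t_n1] := eqVneq t 1.
  rewrite (_ : F = setT) ?cardsT ?card_ord //.
  by apply/setP=> x; rewrite !inE t1 perm1 eqxx.
have ot : #[t] = 2 by apply: nt_prime_order.
have orbitsE : orbit 'P <[t]> @: [set: 'I_11] = porbits t.
  by apply/setP=> X; apply/imsetP/imsetP => -[x _ ->]; exists x; rewrite ?porbitE.
have cycleE : <[t]> = [set 1; t].
  apply/eqP; rewrite eq_sym eqEcard cards2 eq_sym t_n1 -orderE ot.
  by rewrite subUset !sub1set group1 cycle_id.
have fixE g : 'Fix_([set: 'I_11] | 'P)[g] = [set x | g x == x].
  by apply/setP=> x; rewrite in_setI in_setT [RHS]inE; apply/afix1P/eqP.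
have acts_t : [acts <[t]>, on [set: 'I_11] | 'P].
  by apply/actsP=> g _ x; rewrite !inE.
have := Frobenius_Cauchy acts_t; rewrite orbitsE -orderE ot.
rewrite (eq_bigl (mem [set 1; t])) => [|g]; last by rewrite -cycleE.
rewrite big_setU1 ?inE 1?eq_sym // big_set1 !fixE -/F.
have -> : [set x : 'I_11 | (1 : 'S_11) x == x] = setT.
  by apply/setP=> x; rewrite !inE perm1 eqxx.
rewrite cardsT card_ord; move: even_t; rewrite /odd_perm card_ord /=.
(* The number c of cycles is odd and 2c = 11 + |F|, so c is at least 7. *)
case: #|porbits t| => [|[|[|[|[|[|[|n]]]]]]] //= _ eqF.
by rewrite -(ltn_add2l 11) eqF (@leq_trans (7 * 2)) ?leq_mul2r.
Qed.

Lemma cent_joinE_involution (gT : finGroupType) (P : {group gT}) y :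
    #[y] = 2 -> y \in 'C(P) -> y \notin P ->
  P <*> <[y]> = P * <[y]> /\ #|P <*> <[y]>| = (2 * #|P|)%N.
Proof.
move=> oy cPy Py; have joinE : P <*> <[y]> = P * <[y]>.
  by rewrite cent_joinEr // cycle_subG.
split=> //; rewrite joinE TI_cardMg -?orderE ?oy 1?mulnC // setIC.
by apply: prime_TIg; rewrite -?orderE ?oy // cycle_subG.
Qed.

(* The Klein four-group <x, y> is a Sylow 2-subgroup, so no element has an order
   divisible by 4. *)
Lemma expg330_eq1 (gT : finGroupType) (G : {group gT}) (x y : gT) :
    #|G| %| 660 -> x \in G -> y \in G -> commute x y ->
    #[x] = 2 -> #[y] = 2 -> x != y ->
  {in G, forall g, g ^+ 330 = 1}.
Proof.
move=> oG Gx Gy cxy ox oy x_y g Gg.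
have sq1 z : #[z] = 2 -> z ^+ 2 = 1 by move=> oz; rewrite -oz expg_order.
have cxCy : y \in 'C(<[x]>).
  by apply/centP=> _ /cycleP[i ->]; apply: commuteX (commute_sym cxy).
have Xy : y \notin <[x]>.
  apply/cycleP=> -[i yxi]; have := congr1 (fun z => #[z]) yxi.
  rewrite yxi -(expg_mod_order x i) ox modn2 in oy x_y *.
  by case: (odd i) oy x_y => //=; rewrite ?expg1 ?eqxx // expg0 order1.
pose P := (<[x]> <*> <[y]>)%G.
have [defP] := cent_joinE_involution oy cxCy Xy; rewrite -orderE ox => oP.
have sqP z : z \in P -> z ^+ 2 = 1.
  rewrite /= defP => /mulsgP[_ _ /cycleP[i ->] /cycleP[j ->] ->].
  rewrite expgMn; last exact: commuteX2.
  by rewrite -!expgM !(mulnC _ 2) !expgM !sq1 // !expg1n mulg1.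
have sPG : P \subset G by rewrite join_subG !cycle_subG Gx.
have sylP : 2.-Sylow(G) P.
  (* The index of [P] divides 660 / 4 = 165, which is odd. *)
  rewrite /pHall sPG /pgroup oP /=; apply: (@pnat_dvd _ 165) => //.
  by rewrite -(dvdn_pmul2l (isT : 0 < 4)) -[X in (X * _)%N]oP Lagrange.
(* The 2-part of [g] is conjugate into [P], where all squares are trivial. *)
have h2 : (g.`_2) ^+ 2 = 1.
  have sg : <[g.`_2]> \subset G by rewrite cycle_subG groupX.
  have [//|z _] := Sylow_subJ sylP sg; first exact: p_elt_constt.
  rewrite cycle_subG mem_conjg => /sqP; rewrite -conjXg => /eqP.
  by rewrite conjg_eq1 => /eqP.
have og : #[g] \in divisors 660.
  by rewrite -dvdn_divisors // (dvdn_trans _ oG) ?order_dvdG.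
apply/eqP; rewrite -order_dvdn.
have: (4 %| #[g]) || (#[g] %| 330).
  by apply: (allP (_ : all (fun d => (4 %| d) || (d %| 330)) (divisors 660))).
case/orP=> [g4|]; last exact.
have g2 : 4 %| #[g.`_2].
  have n4 : 2.-nat 4 by [].
  by rewrite order_constt -(part_pnat_id n4); apply: partn_dvd (order_gt0 g) g4.
have o2 : #[g.`_2] %| 2 by rewrite order_dvdn h2.
by have := dvdn_trans g2 o2.
Qed.

(** An element of order 11 given by Cauchy has an orbit of size 11, and [v] numbers the points along
    it. *)
Lemma eleven_cycle_conj (G : {group 'S_11}) :
    [transitive G, on [set: 'I_11] | 'P] ->
  exists v : 'S_11, exists2 x, x \in G
    & forall i : 'I_11, x (v i) = v (inord (i.+1 %% 11)).
Proof.
move=> trG; have : 11 %| #|G|.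
  by have := atrans_dvd trG; rewrite cardsT card_ord.
case/Cauchy=> // x Gx ox; have [a xa] : exists a, x a != a.
  apply/existsP; rewrite -negb_forall; apply/negP=> /forallP x1.
  suff x_1 : x = 1 by rewrite x_1 order1 in ox.
  by apply/permP=> a; rewrite perm1; apply/eqP/x1.
have o_a : #|porbit x a| = 11.
  have : #|porbit x a| %| 11.
    by rewrite porbitE; have := dvdn_orbit 'P <[x]> a; rewrite -orderE ox.
  move/(primeP (isT : prime 11)).2 => /orP[/eqP o1|/eqP //].
  have : x a \in porbit x a by apply: (mem_porbit x 1).
  have /cards1P[z xz] : #|porbit x a| == 1%N by apply/eqP.
  have := porbit_id x a; rewrite xz !inE => /eqP <- /eqP xaa.
  by rewrite xaa eqxx in xa.
pose f (i : 'I_11) := nth a (traject x a 11) i.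
have f_inj : injective f.
  move=> i j /eqP; rewrite nth_uniq ?size_traject // => [/eqP/val_inj //|].
  by have := uniq_traject_porbit x a; rewrite o_a.
exists (perm f_inj), x => // i; rewrite !permE /f.
have fE k : k < 11 -> nth a (traject x a 11) k = iter k x a.
  by move=> ?; rewrite nth_traject.
rewrite inordK ?ltn_mod // !fE ?ltn_mod // -iterS.
have [lt_i|] := ltnP i 10; first by rewrite modn_small.
rewrite leq_eqVlt ltnNge -ltnS ltn_ord orbF => /eqP <-.
by have := iter_porbit x a; rewrite o_a.
Qed.

(** * Tables for the computer search *)

Definition tab_exp (k : nat) (p : seq nat) : seq nat :=
  iter k (tab_mul p) (iota 0 (size p)).

Definition affine_tab (m b : nat) : seq nat :=
  [seq (m * x + b) %% 11 | x <- iota 0 11].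

Definition affine (m b : nat) : 'S_11 := perm_of_tab 11 (affine_tab m b).

(* If l lists the first values of an involution of 11 points, then extensions l
   lists the possible continuations of l by one value. *)
Definition extensions (l : seq nat) : seq (seq nat) :=
  let k := size l in
  if k \in l then [:: rcons l (index k l)]
  else [seq rcons l v | v <- iota k (11 - k) & v \notin l].

Definition involution_tabs : seq (seq nat) :=
  iter 9 (fun L => flatten [seq extensions l | l <- L]) [:: [:: 0; 1]]%N.

(* One of the six involutions fixing 0 and 1 that pass the test cycle_words
   below; the other five are conjugate to it under the affine group. *)
Definition t0_tab : seq nat := [:: 0; 1; 3; 2; 6; 8; 4; 10; 5; 9; 7]%N.
Definition t0 : 'S_11 := perm_of_tab 11 t0_tab.

Definition tab_inv (p : seq nat) := [seq index x p | x <- iota 0 11].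

Definition tab_conj (s p : seq nat) := tab_mul (tab_mul (tab_inv p) s) p.

Definition t0_conj_tabs : seq (seq nat) :=
  [seq tab_conj t0_tab (affine_tab m b) | m <- iota 1 10, b <- iota 0 11].

(* The list [:: k; ...; l] stands for the word t c^k ... t c^l in the 11-cycle
   c = affine 1 1. For each involution t fixing 0 and 1 that is not an affine
   conjugate of t0, one of these words has an order that does not divide 330;
   the list was found by machine. *)
Definition cycle_words : seq (seq nat) :=
  [:: [:: 1]; [:: 2]; [:: 3]; [:: 4]; [:: 5]; [:: 1; 2]; [:: 1; 3];
      [:: 10; 6; 10]]%N.

Definition cycle_word_tab (t : seq nat) (w : seq nat) : seq nat :=
  foldr (fun k p => tab_mul t (tab_mul (affine_tab 1 k) p)) (iota 0 11) w.

Definition cycle_word (t : 'S_11) (w : seq nat) : 'S_11 :=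
  foldr (fun k p => t * (affine 1 k * p)) 1 w.

(** The power 330 = 6 * 5 * 11 is taken in three stages, which costs 22 products. The identity
    passes every word test, hence its own clause. *)
Lemma involution_tabs_check :
  all (fun t => [|| t == iota 0 11, t \in t0_conj_tabs
    | has (fun w => tab_exp 11 (tab_exp 5 (tab_exp 6 (cycle_word_tab t w)))
                      != iota 0 11) cycle_words])
    involution_tabs.
Proof. by vm_compute. Qed.

(** Ten rounds reach the whole orbit of 0, since every round before the set is stable adds one of
    the 11 points. *)
Definition orbit_tab (L : seq (seq nat)) : seq nat :=
  iter 10 (fun S => undup (S ++ [seq nth 0 r x | r <- L, x <- S])) [:: 0].

Definition intransitive (L : seq (seq nat)) : bool :=
  let S := orbit_tab L in
  all (fun r => all (fun x => nth 0 r x \in S) S) L && ~~ all (mem S) (iota 0 11).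

(* The points that must carry the names 1, ..., 11, given the one named 1. *)
Definition graph_names (L : seq (seq nat)) (x1 : nat) : seq nat :=
  let step i x := nth 0 (nth [::] L i) x in
  let x2 := step 0 x1 in let x3 := step 1%N x2 in let x4 := step 2 x3 in
  let x5 := step 1%N x4 in let x6 := step 0 x5 in let x7 := step 3 x4 in
  let x8 := step 1%N x7 in let x9 := step 0 x8 in let x10 := step 2 x8 in
  let x11 := step 0 x10 in
  [:: x1; x2; x3; x4; x5; x6; x7; x8; x9; x10; x11].

(** The equations say that [u] conjugates the tables of [eleven] to [L], written without an
    inverse. *)
Definition has_names (L : seq (seq nat)) (u : seq nat) : bool :=
  is_tab 11 u && all (fun i =>
    tab_mul u (nth [::] L i) == tab_mul (nth [::] eleven_tabs i) u) (iota 0 4).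

Definition is_graph (L : seq (seq nat)) : bool :=
  has (fun x => has_names L (graph_names L x)) (iota 0 11).

Definition commuting_tabs (t : seq nat) : seq (seq nat) :=
  [seq s <- t0_conj_tabs | tab_mul s t == tab_mul t s].

(** The first four clauses are the equalities that [gen_neq] excludes. *)
Definition search_ok (r1 r2 r3 : seq nat) : bool :=
  let L := [:: t0_tab; r1; r2; r3] in
  [|| r2 == t0_tab, r3 == t0_tab, t0_tab == tab_exp 3 (tab_mul r2 r3),
      r3 == tab_exp 3 (tab_mul t0_tab r1),
      intransitive L, is_graph L | is_graph (rev L)].

Lemma search_check :
  all (fun r2 => all (fun r3 => all (fun r1 => search_ok r1 r2 r3)
    (commuting_tabs r3)) (commuting_tabs t0_tab)) (commuting_tabs t0_tab).
Proof. by vm_compute. Qed.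

Lemma search_okP r1 r2 r3 : r2 \in commuting_tabs t0_tab ->
  r3 \in commuting_tabs t0_tab -> r1 \in commuting_tabs r3 -> search_ok r1 r2 r3.
Proof.
move=> r2_in r3_in r1_in.
exact: (allP (allP (allP search_check r2 r2_in) r3 r3_in) r1 r1_in).
Qed.

(** * The affine group of Z/11 and the conjugates of [t0] *)

Lemma tabX n (s : 'S_n) k : tab (s ^+ k) = tab_exp k (tab s).
Proof.
elim: k => [|k IHk]; first by rewrite tab1 /tab_exp size_tab.
by rewrite expgS tabM IHk.
Qed.

Lemma tabV (s : 'S_11) : tab s^-1 = tab_inv (tab s).
Proof.
apply: tabP => [|i]; first by rewrite size_map size_iota.
rewrite (nth_map 0) ?size_iota // nth_iota // add0n.
have -> : i = nth 0 (tab s) (s^-1 i) :> nat by rewrite nth_tab permKV.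
rewrite index_uniq ?size_tab //.
by have /and3P[] := is_tab_tab s.
Qed.

Lemma tabJ (s p : 'S_11) : tab (s ^ p) = tab_conj (tab s) (tab p).
Proof. by rewrite conjgE mulgA !tabM tabV. Qed.

Lemma affine_is_tab m b : 0 < m < 11 -> is_tab 11 (affine_tab m b).
Proof.
case/andP=> m_gt0 lt_m; apply/and3P; split; first by rewrite size_map.
  rewrite map_inj_in_uniq ?iota_uniq // => x y.
  rewrite !mem_iota /= => lt_x lt_y /eqP.
  wlog le_xy : x y lt_x lt_y / x <= y => [W|].
    case: (leqP x y) => [|/ltnW le_yx]; first exact: W.
    by rewrite eq_sym => /(W _ _ lt_y lt_x le_yx).
  rewrite eq_sym eqn_mod_dvd ?leq_add2r ?leq_mul2l ?le_xy ?orbT //.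
  rewrite subnDr -mulnBr Euclid_dvdM // => /orP[/(dvdn_leq m_gt0)|].
    by rewrite leqNgt lt_m.
  have [/eqP|d_gt0 /(dvdn_leq d_gt0)] := posnP (y - x).
    by rewrite subn_eq0 => le_yx _; apply/eqP; rewrite eqn_leq le_xy.
  by rewrite leqNgt (leq_ltn_trans (leq_subr _ _) lt_y).
by apply/allP=> _ /mapP[x _ ->] /=; rewrite ltn_mod.
Qed.

Lemma tab_affine m b : 0 < m < 11 -> tab (affine m b) = affine_tab m b.
Proof. by move=> lt_m; rewrite tab_perm_of // affine_is_tab. Qed.

Lemma affineE m b (x : 'I_11) :
  0 < m < 11 -> affine m b x = (m * x + b) %% 11 :> nat.
Proof.
move=> lt_m; rewrite perm_of_tabE ?affine_is_tab //.
by rewrite (nth_map 0) ?size_iota // nth_iota.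
Qed.

Lemma affineM m b m' b' : 0 < m < 11 -> 0 < m' < 11 ->
  affine m b * affine m' b' = affine (m * m' %% 11) ((m' * b + b') %% 11).
Proof.
move=> lt_m lt_m'; have [m_gt0 lt_m11] := andP lt_m.
have [m'_gt0 lt_m'11] := andP lt_m'.
have lt_mm' : 0 < m * m' %% 11 < 11.
  rewrite ltn_mod andbT lt0n -/(dvdn 11 (m * m')) Euclid_dvdM // negb_or.
  by rewrite !gtnNdvd.
apply/permP=> x; apply: ord_inj; rewrite permM !affineE //.
rewrite -modnDml modnMmr modnDml.
rewrite -[RHS]modnDml modnMml modnDml modnDmr mulnDr.
by congr (_ %% 11); rewrite addnA mulnA (mulnC m').
Qed.

Lemma affine1X k : k < 11 -> affine 1 1 ^+ k = affine 1 k.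
Proof.
elim: k => [_|k IHk lt_k].
  by apply: tab_inj; rewrite tab1 tab_affine.
by rewrite expgS IHk ?(ltnW lt_k) // affineM // !mul1n add1n (modn_small lt_k).
Qed.

(** The value v of an involution at k is below k exactly when k is already a value, taken at v;
    otherwise v has not occurred yet. *)
Lemma extensionsP (t : 'S_11) k : t ^+ 2 = 1 -> k < 11 ->
  take k.+1 (tab t) \in extensions (take k (tab t)).
Proof.
move=> tt lt_k; have [sz_t uniq_t lt_t] :
    [/\ size (tab t) = 11, uniq (tab t) & {in tab t, forall x, x < 11}].
  by have /and3P[/eqP ? ? /allP ?] := is_tab_tab t.
have ttE x : x < 11 -> nth 0 (tab t) (nth 0 (tab t) x) = x.
  move=> lt_x; rewrite (nth_tab t (Ordinal lt_x)) nth_tab -permM.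
  by rewrite (_ : t * t = 1) ?perm1.
set v := nth 0 (tab t) k; have lt_v : v < 11 by rewrite lt_t ?mem_nth ?sz_t.
have sz_k : size (take k (tab t)) = k by rewrite size_takel // sz_t ltnW.
have take_k x : x < 11 -> (x \in take k (tab t)) = (nth 0 (tab t) x < k).
  move=> lt_x; rewrite -{1}(ttE x lt_x).
  by rewrite in_take ?index_uniq ?mem_nth ?sz_t // ?lt_t ?mem_nth ?sz_t.
rewrite (take_nth 0) ?sz_t // -/v /extensions sz_k take_k //.
case: ltnP => [lt_vk | le_kv].
  rewrite inE; apply/eqP; congr rcons.
  rewrite -[X in index X _](ttE k lt_k) -/v -[X in index X _](@nth_take k) //.
  by rewrite index_uniq ?sz_k // take_uniq.
apply: map_f; rewrite mem_filter mem_iota le_kv subnKC ?(ltnW lt_k) // lt_v andbT.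
by rewrite take_k // ttE // ltnn.
Qed.

Lemma involution_tabsP (t : 'S_11) : t ^+ 2 = 1 ->
  t ord0 = ord0 -> t (inord 1) = inord 1 -> tab t \in involution_tabs.
Proof.
move=> tt t_0 t_1; have sz_t := size_tab t.
suff IH k : k <= 9 -> take k.+2 (tab t) \in
    iter k (fun L => flatten [seq extensions l | l <- L]) [:: [:: 0; 1]]%N.
  by have := IH 9 (leqnn 9); rewrite take_oversize ?sz_t.
elim: k => [_|k IHk lt_k]; last first.
  apply/flatten_mapP; exists (take k.+2 (tab t)); first exact/IHk/ltnW.
  exact: extensionsP.
rewrite !(take_nth 0) ?sz_t // take0 (nth_tab t ord0) t_0.
have -> : nth 0 (tab t) 1 = 1%N.
  by have := nth_tab t (inord 1); rewrite t_1 inordK.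
by rewrite inE.
Qed.

Section CycleGroup.
Variable G : {group 'S_11}.
Hypothesis G330 : {in G, forall g, g ^+ 330 = 1}.
Hypothesis Gc : affine 1 1 \in G.

Lemma tab_cycle_word t w :
  all (gtn 11) w -> tab (cycle_word t w) = cycle_word_tab (tab t) w.
Proof.
elim: w => [_|k w IHw /=]; first exact: tab1.
by case/andP=> lt_k /IHw <-; rewrite !tabM tab_affine.
Qed.

Lemma fixed_involution_tab t : t \in G -> t ^+ 2 = 1 -> t != 1 ->
  t ord0 = ord0 -> t (inord 1) = inord 1 -> tab t \in t0_conj_tabs.
Proof.
move=> Gt tt t_n1 t_0 t_1.
have /or3P[/eqP t1 | // | /hasP[w w_in /eqP[]]] :=
  allP involution_tabs_check _ (involution_tabsP tt t_0 t_1).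
  by case/eqP: t_n1; apply: tab_inj; rewrite tab1.
have lt_w : all (gtn 11) w.
  by apply: (allP (isT : all (all (gtn 11)) cycle_words)).
(* The word lies in [G], so its power 330 is trivial, against the third clause of the check. *)
rewrite -tab_cycle_word // -!tabX -!expgM -tab1 G330 //.
elim: w lt_w {w_in} => [|k w IHw] /=; first by rewrite group1.
by case/andP=> lt_k /IHw Gw; rewrite !groupM // -affine1X // groupX.
Qed.

End CycleGroup.

Lemma t0_conj_tabsP t : tab t \in t0_conj_tabs ->
  exists m b, [/\ 0 < m < 11, b < 11 & t = t0 ^ affine m b].
Proof.
case/allpairsP=> -[m b]; rewrite !mem_iota => -[lt_m lt_b eq_t].
exists m, b; split=> //; apply: tab_inj.
by rewrite tabJ tab_affine // tab_perm_of.
Qed.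

Lemma mem_t0_conj_tabs m b :
  0 < m < 11 -> b < 11 -> tab (t0 ^ affine m b) \in t0_conj_tabs.
Proof.
move=> lt_m lt_b; apply/allpairsP; exists (m, b); rewrite !mem_iota; split=> //.
by rewrite tabJ tab_affine // tab_perm_of.
Qed.

Lemma affine1J m b : 0 < m < 11 -> affine 1 1 ^ affine m b = affine 1 1 ^+ m.
Proof.
move=> lt_m; rewrite affine1X ?(andP lt_m).2 //; apply: (mulgI (affine m b)).
by rewrite -conjgC !affineM // !mul1n !muln1 addnC.
Qed.

Lemma involution_conj (G : {group 'S_11}) t :
    {in G, forall g, g ^+ 330 = 1} -> affine 1 1 \in G ->
    t \in G -> t ^+ 2 = 1 -> t != 1 -> t \in 'Alt_('I_11) ->
  exists m b, [/\ 0 < m < 11, b < 11 & t = t0 ^ affine m b].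
Proof.
move=> G330 Gc Gt tt t_n1 even_t.
have [a [a' [a'a ta ta']]] := even_involution_fix2 tt even_t.
(* The affine map [p] with slope a' - a takes 0 and 1 to the fixed points [a] and [a']; adding 11 -
   a avoids truncated subtraction. *)
pose m := (a' + (11 - a)) %% 11; pose p := affine m a.
have lt_m : 0 < m < 11.
  rewrite ltn_mod andbT lt0n; apply: contraNneq a'a => m0.
  have := congr1 (fun k => (k + a) %% 11) m0.
  rewrite modnDml -addnA subnK ?(ltnW (ltn_ord a)) // modnDr add0n.
  by rewrite !modn_small // => /val_inj->.
have p0 : p ord0 = a.
  by apply: ord_inj; rewrite affineE //= muln0 add0n modn_small.
have p1 : p (inord 1) = a'.
  apply: ord_inj; rewrite affineE // inordK // muln1 modnDml -addnA.
  by rewrite subnK ?(ltnW (ltn_ord a)) // modnDr modn_small.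
have G'330 : {in G :^ p^-1, forall g, g ^+ 330 = 1}.
  move=> g; rewrite mem_conjgV => /G330; rewrite -conjXg => /eqP.
  by rewrite conjg_eq1 => /eqP.
have Gc' : affine 1 1 \in G :^ p^-1.
  by rewrite mem_conjgV affine1J // groupX.
have tab_tp : tab (t ^ p^-1) \in t0_conj_tabs.
  apply: (fixed_involution_tab G'330 Gc').
  - by rewrite memJ_conjg.
  - by rewrite -conjXg tt conj1g.
  - by rewrite conjg_eq1.
  - by rewrite -{1}[ord0](permK p) permJ p0 ta -p0 permK.
  by rewrite -{1}[inord 1](permK p) permJ p1 ta' -p1 permK.
have [k [b [lt_k lt_b tE]]] := t0_conj_tabsP tab_tp.
exists (k * m %% 11), ((m * b + a) %% 11).
rewrite -affineM // conjgM -tE conjgKV.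
split=> //; rewrite ?ltn_mod // andbT lt0n.
rewrite -/(dvdn 11 (k * m)) Euclid_dvdM // negb_or !gtnNdvd //.
- by case/andP: lt_m.
- by case/andP: lt_m.
- by case/andP: lt_k.
by case/andP: lt_k.
Qed.

(** * From the generators to the graph *)

Lemma transitive_tab n (rho : seq 'S_n.+1) :
  (forall x y, exists w, word rho w x = y) ->
  forall S : seq nat, 0 \in S ->
    all (fun r => all (fun x => nth 0 r x \in S) S) [seq tab s | s <- rho] ->
  all (mem S) (iota 0 n.+1).
Proof.
move=> trans S S0 /allP S_closed; apply/all_ordP=> y; have [w <-] := trans ord0 y.
have: nat_of_ord (@ord0 n) \in S by [].
elim: w (ord0) => [|i w IHw] x Sx; first by rewrite /word big_nil perm1.
rewrite /word big_cons permM; apply: IHw.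
have [lt_i|le_i] := ltnP i (size rho); last by rewrite nth_default // perm1.
rewrite -nth_tab; apply: (allP (S_closed _ _)) => //.
by apply: map_f; apply: mem_nth.
Qed.

Lemma mem_orbit_tab L : 0 \in orbit_tab L.
Proof.
rewrite /orbit_tab; elim: 10 => [//|k IHk].
by rewrite iterS mem_undup mem_cat IHk.
Qed.

Lemma is_graphP (rho : seq 'S_11) : size rho = 4 -> is_graph [seq tab s | s <- rho] ->
  exists u, rho = [seq s ^ u | s <- eleven].
Proof.
move=> sz_rho /hasP[x _ /andP[]]; set l := graph_names _ x => u_tab l_names.
exists (perm_of_tab 11 l).
apply: (@eq_from_nth _ 1) => [|i]; rewrite ?size_map // sz_rho => lt_i.
rewrite (nth_map 1) // conjgE; apply: (mulgI (perm_of_tab 11 l)).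
rewrite !mulgA mulgV mul1g; apply: tab_inj.
rewrite !tabM tab_perm_of // tab_eleven //.
by have := all_iota l_names lt_i; rewrite (nth_map 1) ?sz_rho // => /eqP.
Qed.

(** The facts used by the search, gathered so that they pass together to a conjugate. *)
Record generators (G : {group 'S_11}) (rho : seq 'S_11) : Prop := Generators {
  gen_size : size rho = 4;
  gen_involution :
    {in rho, forall x, [/\ x \in G, x ^+ 2 = 1, x != 1 & x \in 'Alt_('I_11)]};
  gen_commute : let r := nth 1 rho in
    [/\ r 0 * r 2 = r 2 * r 0, r 0 * r 3 = r 3 * r 0
      & r 1%N * r 3 = r 3 * r 1%N];
  (* In every other transitive solution of the search, rho_0 = (rho_2 rho_3)^3 or
     rho_3 = (rho_0 rho_1)^3, against the intersection property. *)
  gen_neq : let r := nth 1 rho in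
    [/\ r 0 != r 2, r 0 != r 3, r 0 != (r 2 * r 3) ^+ 3
      & r 3 != (r 0 * r 1%N) ^+ 3];
  gen_trans : forall x y, exists w, word rho w x = y;
  gen_expg330 : {in G, forall g, g ^+ 330 = 1} }.

Lemma generators_conj G rho z :
  generators G rho -> generators (G :^ z)%G [seq x ^ z | x <- rho].
Proof.
case=> sz inv com neq trans exp.
have nth_z i : i < 4 -> nth 1 [seq x ^ z | x <- rho] i = nth 1 rho i ^ z.
  by move=> lt_i; rewrite (nth_map 1) ?sz.
split=> /=; rewrite ?nth_z //.
- by rewrite size_map.
- move=> _ /mapP[x /inv[Gx xx x1 Ax] ->].
  rewrite memJ_conjg -conjXg xx conj1g conjg_eq1.
  by rewrite Alt_even odd_permJ -Alt_even.
- by case: com => c02 c03 c13; rewrite -!conjMg c02 c03 c13.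
- case: neq => n02 n03 n0 n3.
  by rewrite -!conjMg -!conjXg !(inj_eq (conjg_inj z)).
- move=> x y; have [w w_xy] := trans (z^-1 x) (z^-1 y); exists w.
  by rewrite word_map_conj -[x](permKV z) permJ w_xy permKV.
move=> g; rewrite mem_conjg => /exp; rewrite -conjXg => /eqP.
by rewrite conjg_eq1 => /eqP.
Qed.

Lemma generators_graph_t0 G rho :
    generators G rho -> affine 1 1 \in G -> nth 1 rho 0 = t0 ->
  exists u, rho = [seq s ^ u | s <- eleven] \/
            rev rho = [seq s ^ u | s <- eleven].
Proof.
case: rho => [|r0 [|r1 [|r2 [|r3 [|? ?]]]]] []//= _ inv.
move=> [c02 c03 c13] [n02 n03 n0 n3] trans exp Gc r0E.
have tab0 : tab r0 = t0_tab by rewrite r0E tab_perm_of.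
have tabs r : r \in [:: r0; r1; r2; r3] -> tab r \in t0_conj_tabs.
  case/inv=> Gr rr r_n1 Ar.
  have [m [b [lt_m lt_b ->]]] := involution_conj exp Gc Gr rr r_n1 Ar.
  exact: mem_t0_conj_tabs.
have tab_commute x y :
    x * y = y * x -> tab_mul (tab x) (tab y) == tab_mul (tab y) (tab x).
  by move=> cxy; rewrite -!tabM cxy.
have check : search_ok (tab r1) (tab r2) (tab r3).
  by apply: search_okP;
    rewrite mem_filter -?tab0 tab_commute ?tabs ?inE ?eqxx ?orbT.
move: check; rewrite /search_ok -tab0 -!tabM -!tabX !(inj_eq (@tab_inj 11)).
(* The inequalities remove four clauses, leaving intransitivity and the two graphs. *)
rewrite ![_ == r0]eq_sym (negPf n02) (negPf n03) (negPf n0) (negPf n3) !orFb.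
case/or3P.
- case/andP=> S_closed /negP[].
  exact: (transitive_tab trans (mem_orbit_tab _) S_closed).
- by case/(@is_graphP [:: r0; r1; r2; r3])=> // u ->; exists u; left.
by case/(@is_graphP [:: r3; r2; r1; r0])=> // u eq_u; exists u; right.
Qed.

(** A first conjugation brings the 11-cycle x |-> x + 1 into the group; a second one, by an affine
    map normalising this cycle, turns rho_0 into [t0]. *)
Lemma generators_graph G rho :
    generators G rho -> [transitive G, on [set: 'I_11] | 'P] ->
  exists u, rho = [seq s ^ u | s <- eleven] \/
            rev rho = [seq s ^ u | s <- eleven].
Proof.
move=> genG trG.
suff [z [u zu]] : exists z u, let rho_z := [seq x ^ z | x <- rho] in
    rho_z = [seq s ^ u | s <- eleven] \/
    rev rho_z = [seq s ^ u | s <- eleven].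
  have unconj (s : seq 'S_11) :
      [seq x ^ z | x <- s] = [seq x ^ u | x <- eleven] ->
      s = [seq x ^ (u * z^-1) | x <- eleven].
    move=> eq_s; have /(congr1 (map (conjg^~ z^-1))) := eq_s; rewrite -!map_comp.
    rewrite map_id_in => [->|x _]; last by rewrite /= conjgK.
    by apply: eq_map => x; rewrite /= conjgM.
  exists (u * z^-1); case: zu => [/unconj|]; first by left.
  by rewrite -map_rev => /unconj; right.
have [v [x Gx xv]] := eleven_cycle_conj trG.
have Gc : affine 1 1 \in G :^ v^-1.
  rewrite mem_conjgV; congr (_ \in G): Gx; apply: (mulgI v); rewrite -conjgC.
  apply/permP=> i; rewrite !permM xv; congr (v _); apply: ord_inj.
  by rewrite affineE // mul1n addn1 inordK // ltn_mod.
have genV := generators_conj v^-1 genG.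
set rho1 := map _ _ in genV.
have lt_rho1 : 0 < size rho1 by rewrite (gen_size genV).
have [r0G r00 r0_n1 r0A] := gen_involution genV (mem_nth 1 lt_rho1).
have [m [b [lt_m lt_b r0E]]] :=
  involution_conj (gen_expg330 genV) Gc r0G r00 r0_n1 r0A.
exists (v^-1 * (affine m b)^-1).
have eq_rho : [seq x ^ (v^-1 * (affine m b)^-1) | x <- rho]
    = [seq x ^ (affine m b)^-1 | x <- rho1].
  by rewrite -map_comp; apply: eq_map => y; rewrite /= conjgM.
rewrite eq_rho.
apply: (generators_graph_t0 (generators_conj (affine m b)^-1 genV)).
  by rewrite mem_conjgV affine1J // groupX.
by rewrite (nth_map 1) // r0E conjgK.
Qed.

(** * The intersection property and the conclusion *)

Lemma string_C_group_notin (gT : finGroupType) (G : {group gT}) (rho : seq gT)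
    i (K : seq nat) :
    string_C_group G rho -> i < size rho -> all (gtn (size rho)) K ->
    i \notin K ->
  nth 1 rho i \notin <<[set x in [seq nth 1 rho k | k <- K]]>>.
Proof.
case=> -[_ ord2 _] C lt_i /allP lt_K iK; apply/negP => rho_i.
pose J : {set 'I_(size rho)} := [set Ordinal lt_i].
pose K' : {set 'I_(size rho)} := [set k | val k \in K].
have JK : J :&: K' = set0.
  apply/setP=> k; rewrite !inE; apply/negP=> /andP[/eqP-> /=].
  by apply/negP.
have : nth 1 rho i \in parabolic J :&: parabolic K'.
  rewrite inE; apply/andP; split.
    by apply: mem_gen; apply/imsetP; exists (Ordinal lt_i); rewrite // set11.
  apply: subsetP rho_i; apply: genS; apply/subsetP=> x.
  rewrite inE => /mapP[k Kk ->].
  by apply/imsetP; exists (Ordinal (lt_K k Kk)); rewrite ?inE.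
(* By the intersection property the disjoint index sets give a trivial intersection, but rho_i has
   order 2. *)
rewrite C JK /parabolic imset0 gen0 => /set1P rho1.
by have := ord2 _ (mem_nth 1 lt_i); rewrite rho1 order1.
Qed.

Lemma involution_commute (gT : finGroupType) (x y : gT) :
  x ^+ 2 = 1 -> y ^+ 2 = 1 -> (x * y) ^+ 2 = 1 -> x * y = y * x.
Proof.
have inv2 (z : gT) : z ^+ 2 = 1 -> z^-1 = z.
  by move=> zz; apply: (mulgI z); rewrite mulgV -zz.
by move=> /inv2 xV /inv2 yV /inv2 <-; rewrite invMg xV yV.
Qed.

(* The graph is determined up to duality: the 11-cell is self-dual, but its
   duality is not induced by a permutation of the 11 points. *)
Theorem proposition8p1 (r : nat) (G : {group 'S_11}) (rho : r.-tuple 'S_11) :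
  string_C_group G rho ->
  [transitive G, on [set: 'I_11] | 'P] ->
  G \subset 'Alt_('I_11) ->
  r \in [:: 4; 5] ->
  G \isog PSL 2 'F_11 ->
  is_eleven_cell G rho /\
  (has_perm_rep_graph rho eleven_cell_graph \/
   has_perm_rep_graph (rev rho) eleven_cell_graph).
Proof.
move=> CG trG altG r45 isoG; have [[genG ord2 com] C] := CG.
have oG : #|G| %| 660 by rewrite (card_isog isoG) dvdn_card_PSL2_11.
have sz : size rho = r := size_tuple rho.
have lt4 i : i < 4 -> i < size rho.
  by rewrite sz; move: r45; rewrite !inE => /orP[] /eqP-> // /ltnW.
have rG i : nth 1 rho i \in G by rewrite genG -word1 mem_word.
have o2 i : i < size rho -> #[nth 1 rho i] = 2.
  by move=> lt_i; apply/ord2/mem_nth.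
have sq1 i : i < size rho -> nth 1 rho i ^+ 2 = 1.
  by move=> lt_i; have := expg_order (nth 1 rho i); rewrite o2.
have commut i j : j < size rho -> i.+1 < j ->
    nth 1 rho i * nth 1 rho j = nth 1 rho j * nth 1 rho i.
  move=> lt_j lt_ij; have lt_i := ltn_trans (ltnW lt_ij) lt_j.
  apply: involution_commute; rewrite ?sq1 //.
  by apply: (com (Ordinal lt_i) (Ordinal lt_j)); rewrite lt_ij.
have notin i K : i < size rho -> all (gtn 4) K -> i \notin K ->
    nth 1 rho i \notin <<[set x in [seq nth 1 rho k | k <- K]]>>.
  move=> lt_i K4; apply: string_C_group_notin => //.
  by apply/allP=> k /(allP K4)/lt4.
have neq i j : i < size rho -> j < 4 -> i != j -> nth 1 rho i != nth 1 rho j.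
  move=> lt_i lt_j i_j; have := @notin i [:: j] lt_i.
  rewrite /= lt_j inE => /(_ isT i_j).
  by apply: contraNneq => ->; rewrite mem_gen // !inE.
have {r45} sz4 : size rho = 4.
  move: r45; rewrite sz !inE => /orP[/eqP // | /eqP r5].
  have lt_4 : 4 < size rho by rewrite sz r5.
  have notin02 : nth 1 rho 2 \notin <[nth 1 rho 0]>.
    have := @notin 2 [:: 0] (lt4 2 isT) isT isT.
    rewrite /= (_ : [set x in [:: nth 1 rho 0]] = [set nth 1 rho 0]) //.
    by apply/setP=> x; rewrite !inE.
  have cent02 : nth 1 rho 2 \in 'C(<[nth 1 rho 0]>).
    by rewrite cent_cycle; apply/cent1P/esym/commut => //; apply: lt4.
  have [_ o02] := cent_joinE_involution (o2 2 (lt4 2 isT)) cent02 notin02.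
  have cent4 : nth 1 rho 4 \in 'C(<[nth 1 rho 0]> <*> <[nth 1 rho 2]>).
    by rewrite centY inE !cent_cycle; apply/andP; split; apply/cent1P/esym/commut.
  have notin4 : nth 1 rho 4 \notin <[nth 1 rho 0]> <*> <[nth 1 rho 2]>.
    apply: contra (@notin 4 [:: 0; 2]%N lt_4 isT isT); apply: subsetP.
    by rewrite join_subG !cycle_subG !mem_gen // !inE eqxx ?orbT.
  have [_ o024] := cent_joinE_involution (P := _ <*> _) (o2 4 lt_4) cent4 notin4.
  have : #|<[nth 1 rho 0]> <*> <[nth 1 rho 2]> <*> <[nth 1 rho 4]>| %| 660.
    by apply: dvdn_trans oG; apply: cardSg; rewrite !join_subG !cycle_subG !rG.
  by rewrite o024 o02 -orderE o2 ?lt4.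
have genR : generators G rho.
  split=> //.
  - move=> x rho_x; rewrite -(nth_index 1 rho_x) rG sq1 ?index_mem //.
    split=> //; last exact: (subsetP altG _ (rG _)).
    by rewrite -order_gt1 o2 ?index_mem.
  - by split; apply: commut; rewrite ?lt4.
  - split; [by apply: neq; rewrite ?lt4 | by apply: neq; rewrite ?lt4 | |].
      (* Equality would put rho_0 into the subgroup generated by rho_2 and rho_3; the next case is
         the same for rho_3. *)
      have := @notin 0 [:: 2; 3]%N (lt4 0 isT) isT isT; apply: contraNneq => ->.
      by rewrite groupX // groupM // mem_gen // !inE eqxx ?orbT.
    have := @notin 3 [:: 0; 1]%N (lt4 3 isT) isT isT; apply: contraNneq => ->.
    by rewrite groupX // groupM // mem_gen // !inE eqxx ?orbT.
  - move=> x y; have : y \in orbit 'P G x by rewrite (atransP trG) ?inE.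
    by case/orbitP=> g; rewrite genG => /gen_word[w ->] <-; exists w.
  apply: (expg330_eq1 oG (rG 0) (rG 2)).
  - by apply: commut; rewrite ?lt4.
  - by apply: o2; apply: lt4.
  - by apply: o2; apply: lt4.
  by apply: neq; rewrite ?lt4.
have [u rhoE] := generators_graph genR trG.
split; last by case: rhoE => /eleven_cell_graphE; [left | right].
apply: is_eleven_cell_same_rel => //.
case: rhoE => [->|rev_rho]; first exact/same_rel_sym/same_rel_conj.
(* Here [rho] has the relations of [rev eleven], which are those of [eleven]. *)
rewrite -[tval rho]revK rev_rho.
apply: (same_rel_trans (same_rel_rev (same_rel_sym (same_rel_conj eleven u)))).
exact: same_rel_sym same_rel_eleven_rev.
Qed.
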